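(* Let us assume that $\omega\in\mathfrak{A}$, where $\mathfrak{A}\subset\mathbb{R}$ is a band gap. Then the surface impedance decreases with respect to the frequency, i.e. $$\frac{dZ^+}{d\omega}<0,\qquad \frac{dZ^-}{d\omega}<0,\qquad \text{for }\omega\in\mathfrak{A}.$$
   Context: Setting. $\mu_0>0$ is a constant (the magnetic permeability). The permittivities $\varepsilon_1,\varepsilon_2$ are real-valued (no damping), continuous functions of the frequency $\omega\in\mathbb{R}$, and are assumed to be piecewise non-decreasing in $\omega$, in the sense that $\frac{d\varepsilon}{d\omega}\ge 0$ whenever the derivative exists. Two materials $A$ and $B$ are semi-infinite arrays glued together at $x_0=0$; $A$ extends towards $-\infty$ and $B$ towards $+\infty$. Each is obtained by periodically repeating (with period $1$) a unit cell made of consecutive intervals (particles) in the order $D^{[1]}_1,D^{[2]}_1,D^{[1]}_2,\dots,D^{[2]}_N,D^{[1]}_{N+1}$ (the geometry depends on the material). The permittivity is $\varepsilon(x,\omega)=\varepsilon_1(\omega)$ on the particles $D^{[1]}_i$ and $\varepsilon(x,\omega)=\varepsilon_2(\omega)$ on the particles $D^{[2]}_i$. Each unit cell is mirror symmetric: in each material, with the cell identified with $[0,1]$, $\varepsilon(x,\omega)=\varepsilon(1-x,\omega)$ for $x\in[0,1]$. The equation considered is $$-\frac{1}{\mu_0}\frac{d}{dx}\left(\frac{1}{\varepsilon(x,\omega)}\frac{du}{dx}\right)=\omega^2u .$$ The spectral bands of a material are the sets of frequencies $\omega=\omega_n(\kappa)$ for which the equation in the corresponding periodic medium has a non-zero solution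 with $u(x+1)=e^{i\kappa}u(x)$ and $u'(x+1)=e^{i\kappa}u'(x)$ for some $\kappa\in[-\pi,\pi]$; a band gap is an interval of frequencies between consecutive bands. Surface impedances: with $f(\alpha^-)$ and $f(\alpha^+)$ denoting the left and right limits of $f$ at $\alpha$, $$Z^-(\omega)=-\frac{u(x_0^-)}{\frac{1}{\varepsilon_1(\omega)}\frac{du}{dx}(x_0^-)},\qquad Z^+(\omega)=\frac{u(x_0^+)}{\frac{1}{\varepsilon_1(\omega)}\frac{du}{dx}(x_0^+)},\qquad \omega\in\mathbb{R},$$ where, for $\omega$ in a band gap, $u$ in $Z^-$ (resp. $Z^+$) is the non-zero solution of the equation in material $A$ (resp. $B$) that decays as $x\to-\infty$ (resp. $x\to+\infty$).
   Formalization: Stated for ω>0 (for constant permittivities Z is even in ω, so the claim fails at ω<0), with ε₁,ε₂ nonzero at ω and differentiable off a locally finite set; Z is differentiable where ε₁,ε₂ are, and dZ/dω<0 wherever it exists (it may not exist at kinks). *)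

(* Defs.v *)
From Stdlib Require Import Reals ZArith ClassicalEpsilon.
From Coquelicot Require Import Coquelicot.

Open Scope R_scope.

(* [locally' w] is the punctured neighbourhood filter: the exceptional
   frequencies, where [eps] is not differentiable, form a locally finite set.
   This is the meaning given to "piecewise". *)
Definition piecewise_nondecreasing (eps : R -> R) : Prop :=
  (forall w : R, locally' w (fun y => ex_derive eps y)) /\
  (forall w : R, ex_derive eps w -> 0 <= Derive eps w).

Definition permittivity (eps : R -> R) : Prop :=
  (forall w : R, continuous eps w) /\ piecewise_nondecreasing eps.

(* The cell [0,1] is cut at [node 0 = 0 < node 1 < ... < node (2N+1) = 1].
   Counting from 0, the i-th particle of the first kind (i <= N) is
   [node (2i), node (2i+1)] and the i-th particle of the second kind (i < N)
   is (node (2i+1), node (2i+2)). *)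
Record unit_cell : Type := UnitCell {
  cell_N : nat;
  node : nat -> R;
  cell_N_pos : (1 <= cell_N)%nat;
  node_first : node 0%nat = 0;
  node_last : node (2 * cell_N + 1)%nat = 1;
  node_increasing :
    forall i : nat, (i < 2 * cell_N + 1)%nat -> node i < node (S i)
}.

(* Particles of the first kind are taken closed, so that the set is the
   1-periodic extension of its trace on the cell and the pointwise mirror
   symmetry below is not spoiled at the end points of the particles. *)
Definition in_first_particle (M : unit_cell) (x : R) : Prop :=
  exists (k : Z) (i : nat), (i <= cell_N M)%nat /\
    node M (2 * i)%nat <= x - IZR k <= node M (2 * i + 1)%nat.

Definition interface (M : unit_cell) (x : R) : Prop :=
  exists (k : Z) (i : nat), (i <= 2 * cell_N M + 1)%nat /\
    x = IZR k + node M i.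

Definition eps_medium (eps1 eps2 : R -> R) (M : unit_cell) (x w : R) : R :=
  if excluded_middle_informative (in_first_particle M x)
  then eps1 w else eps2 w.

Definition mirror_symmetric (eps1 eps2 : R -> R) (M : unit_cell) : Prop :=
  forall w x : R, 0 <= x <= 1 ->
    eps_medium eps1 eps2 M x w = eps_medium eps1 eps2 M (1 - x) w.

(* [u] solves  - 1/mu0 (u' / eps)' = w^2 u  on the open set [I], with the
   usual meaning for piecewise constant coefficients: [u] and the flux
   [q = u' / eps] are continuous across the interfaces.  The values are in a
   real normed space so as to cover both real and complex solutions. *)
Definition solution {V : NormedModule R_AbsRing} (mu0 : R)
  (eps1 eps2 : R -> R) (M : unit_cell) (w : R) (I : R -> Prop)
  (u : R -> V) : Prop :=
  exists q : R -> V,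
    (forall x, I x -> continuous u x) /\
    (forall x, I x -> ~ interface M x ->
       exists du : V, is_derive u x du /\
         q x = scal (/ eps_medium eps1 eps2 M x w) du) /\
    (forall x, I x ->
       exists dq : V, is_derive q x dq /\
         scal (- / mu0) dq = scal (w ^ 2) (u x)).

Definition Cexpi (kappa : R) : C := (cos kappa, sin kappa).

(* Frequencies lying in a spectral band of the periodic medium.  The
   conditions on [eps1 w] and [eps2 w] say that the equation makes sense. *)
Definition band_frequency (mu0 : R) (eps1 eps2 : R -> R) (M : unit_cell)
  (w : R) : Prop :=
  eps1 w <> 0 /\ eps2 w <> 0 /\
  exists (kappa : R) (u : R -> C_R_NormedModule),
    - PI <= kappa <= PI /\
    solution mu0 eps1 eps2 M w (fun _ => True) u /\
    (exists x : R, u x <> zero) /\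
    (forall x : R, u (x + 1) = Cmult (Cexpi kappa) (u x)) /\
    (forall (x : R) (du : C), is_derive u x du ->
       is_derive u (x + 1) (Cmult (Cexpi kappa) du)).

(* An open interval free of band frequencies, both end points of which
   adhere to the bands. *)
Definition band_gap (mu0 : R) (eps1 eps2 : R -> R) (M : unit_cell)
  (gap : R -> Prop) : Prop :=
  exists a b : R, a < b /\
    (forall w, gap w <-> a < w < b) /\
    (forall w, gap w -> ~ band_frequency mu0 eps1 eps2 M w) /\
    (forall c, c = a \/ c = b -> forall d : R, 0 < d ->
       exists w, Rabs (w - c) < d /\ band_frequency mu0 eps1 eps2 M w).

(* The decaying solution is unique up to a scalar and the equation is real,
   so real solutions suffice for the impedances.  Here x_0 = 0. *)
Definition is_impedance_minus (mu0 : R) (eps1 eps2 : R -> R) (A : unit_cell)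
  (w z : R) : Prop :=
  exists (u : R -> R) (u0 du0 : R),
    solution mu0 eps1 eps2 A w (fun x => x < 0) u /\
    (exists x, x < 0 /\ u x <> 0) /\
    is_lim u m_infty 0 /\
    filterlim u (at_left 0) (locally u0) /\
    filterlim (Derive u) (at_left 0) (locally du0) /\
    z = - (u0 / (/ eps1 w * du0)).

Definition is_impedance_plus (mu0 : R) (eps1 eps2 : R -> R) (B : unit_cell)
  (w z : R) : Prop :=
  exists (u : R -> R) (u0 du0 : R),
    solution mu0 eps1 eps2 B w (fun x => 0 < x) u /\
    (exists x, 0 < x /\ u x <> 0) /\
    is_lim u p_infty 0 /\
    filterlim u (at_right 0) (locally u0) /\
    filterlim (Derive u) (at_right 0) (locally du0) /\
    z = u0 / (/ eps1 w * du0).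

(* [epsilon] returns the value singled out by the predicate; its default for
   frequencies without a decaying solution is irrelevant. *)
Definition impedance_minus (mu0 : R) (eps1 eps2 : R -> R) (A : unit_cell)
  (w : R) : R :=
  epsilon (inhabits 0) (is_impedance_minus mu0 eps1 eps2 A w).

Definition impedance_plus (mu0 : R) (eps1 eps2 : R -> R) (B : unit_cell)
  (w : R) : R :=
  epsilon (inhabits 0) (is_impedance_plus mu0 eps1 eps2 B w).

(* Main.v *)
Require Import Defs.
From Stdlib Require Import Reals.
From Coquelicot Require Import Coquelicot.
From Stdlib Require Import ZArith List Lia Lra ClassicalEpsilon.

Open Scope R_scope.

(** With the flux [q = u' / eps] and [m = mu0 w^2], the equation becomes the
    first-order system [u' = eps q], [q' = - m u], whose solutions for a piecewise
    constant medium are explicit.  Carrying data [(u, q)] through a unit cell is a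
    linear map of determinant 1, the monodromy matrix with rows [(a, b)] and [(c, d)]
    ([monodromy_matrix], [monodromy_det]).

    Comparing a solution with the mirror image of another one shows that mirror
    symmetry forces [d = a] ([mirror_mon_d]), so that [b c = a^2 - 1].  When
    [|a| <= 1] there is a multiplier [exp (i kappa)], hence a quasi-periodic
    solution and a band frequency ([band_of_half_trace]).  In a gap therefore
    [|a| > 1].  With [r] the square root of [a^2 - 1] having the sign of [a], the
    vectors [(b, - r)] and [(b, r)] are eigenvectors for [a - r] and [a + r], of
    modulus below and above 1.  They generate the solutions decaying to the right
    and to the left, and by constancy of Wronskians every decaying solution is a
    multiple of those ([decaying_multiple]).  Both [Z^+] and [Z^-] are thus equal
    to [- b / r] ([impedance_plus_eq], [impedance_minus_eq]); in particular symmetry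
    excludes zeros and poles in the gap, and the impedance is differentiable as
    soon as the permittivities are.

    For the sign, let [(u, q)] and [(v, p)] be the solutions decaying to the right
    at two frequencies [w0 < w], with data [(b, - r)], and put [W = v q - u p].
    Then
    [[
      W' = (eps(w) - eps(w0)) q p + (m(w) - m(w0)) u v ,
    ]]
    and [W(1) = l W(0)], where [l], the product of the two multipliers, satisfies
    [|l| < 1].  As [w] tends to [w0] the factors [q p] and [u v] tend uniformly on
    the cell to squares that do not vanish identically, and [eps] does not decrease,
    so that [W(1) - W(0) >= c (w - w0)] with [c > 0] ([particle_increase],
    [transfer_increase]).  Hence [W(0)] is at most [- (c / 2) (w - w0)], and so is,
    up to a positive factor, the difference of the impedances, which is
    [W(0) / (r(w0) r(w))] ([gap_impedance_slope]).  No differentiability of the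
    permittivities is needed for this bound. *)

(** * Two entire functions *)

(** Taylor coefficients of [cosh (sqrt z)] and [sinh (sqrt z) / sqrt z]. *)
Definition ck_coef (n : nat) : R := / INR (fact (2 * n)).
Definition sk_coef (n : nat) : R := / INR (fact (2 * n + 1)).

(** [Ck z] is [cosh (sqrt z)] and [Sk z] is [sinh (sqrt z) / sqrt z], read as
    entire functions of [z]; they handle both signs of [z] (and [z = 0]) at
    once. *)
Definition Ck (z : R) : R := PSeries ck_coef z.
Definition Sk (z : R) : R := PSeries sk_coef z.

Lemma ratio_lim (a : nat -> R) :
  (forall n, a n <> 0) ->
  (forall n, Rabs (a (S n) / a n) <= / INR (S n)) -> CV_radius a = p_infty.
Proof.
  intros ha hr. apply CV_radius_infinite_DAlembert; auto.
  apply (is_lim_seq_le_le (fun _ => 0) _ (fun n => / INR (S n))).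
  - intros n; split; [apply Rabs_pos | apply hr].
  - apply is_lim_seq_const.
  - apply (is_lim_seq_inv (fun n => INR (S n)) p_infty); [|discriminate].
    apply (is_lim_seq_incr_1 INR), is_lim_seq_INR.
Qed.

Lemma ratio_le (n k : nat) : (n <= k)%nat ->
  Rabs (/ INR (fact (S (S k))) / / INR (fact k)) <= / INR (S n).
Proof.
  intros h.
  change (fact (S (S k))) with (S (S k) * (S k * fact k))%nat.
  rewrite !mult_INR.
  pose proof (INR_fact_lt_0 k) as hf.
  pose proof (lt_0_INR (S k) ltac:(lia)) as h1.
  pose proof (lt_0_INR (S n) ltac:(lia)) as h3.
  assert (h2 : 1 <= INR (S (S k))) by (apply (le_INR 1); lia).
  assert (h4 : INR (S n) <= INR (S k)) by (apply le_INR; lia).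
  replace (/ (INR (S (S k)) * (INR (S k) * INR (fact k))) / / INR (fact k))
    with (/ (INR (S (S k)) * INR (S k))) by (field; lra).
  rewrite Rabs_pos_eq.
  - apply Rinv_le_contravar; nra.
  - left; apply Rinv_0_lt_compat; nra.
Qed.

Lemma ck_radius : CV_radius ck_coef = p_infty.
Proof.
  apply ratio_lim.
  - intros n; apply Rinv_neq_0_compat, INR_fact_neq_0.
  - intros n; unfold ck_coef.
    replace (2 * S n)%nat with (S (S (2 * n))) by lia.
    apply ratio_le; lia.
Qed.

Lemma sk_radius : CV_radius sk_coef = p_infty.
Proof.
  apply ratio_lim.
  - intros n; apply Rinv_neq_0_compat, INR_fact_neq_0.
  - intros n; unfold sk_coef.
    replace (2 * S n + 1)%nat with (S (S (2 * n + 1))) by lia.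
    apply ratio_le; lia.
Qed.

Lemma Ck_derive (z : R) : is_derive Ck z (Sk z / 2).
Proof.
  evar_last.
  - apply is_derive_PSeries. rewrite ck_radius. exact I.
  - unfold Sk. rewrite (PSeries_ext _ (PS_scal (/ 2) sk_coef)).
    + rewrite PSeries_scal. field.
    + intros n. unfold PS_derive, PS_scal, ck_coef, sk_coef.
      change (scal ?x ?y) with (x * y).
      replace (2 * S n)%nat with (S (2 * n + 1)) by lia.
      change (fact (S (2 * n + 1))) with (S (2 * n + 1) * fact (2 * n + 1))%nat.
      rewrite mult_INR.
      replace (INR (S (2 * n + 1))) with (2 * INR (S n)).
      * field. split; [apply INR_fact_neq_0 | apply not_0_INR; lia].
      * change 2 with (INR 2). rewrite <- mult_INR. f_equal. lia.
Qed.

(** Derivative of [Sk]. *)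
Definition dSk (z : R) : R := PSeries (PS_derive sk_coef) z.

Lemma Sk_derive (z : R) : is_derive Sk z (dSk z).
Proof. apply is_derive_PSeries. rewrite sk_radius. exact I. Qed.

Lemma Sk_dSk (z : R) : Sk z + 2 * z * dSk z = Ck z.
Proof.
  unfold Sk, dSk, Ck. rewrite Rmult_assoc, <- PSeries_incr_1, <- PSeries_scal.
  rewrite <- PSeries_plus.
  - apply PSeries_ext. intros n.
    unfold PS_plus, PS_scal, PS_incr_1, PS_derive, ck_coef, sk_coef.
    change (scal ?x ?y) with (x * y). change (plus ?x ?y) with (x + y).
    destruct n as [|n].
    + simpl. change zero with 0. field.
    + replace (2 * S n + 1)%nat with (S (2 * S n)) by lia.
      change (fact (S (2 * S n))) with (S (2 * S n) * fact (2 * S n))%nat.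
      rewrite mult_INR, (S_INR (2 * S n)), mult_INR. change (INR 2) with 2.
      pose proof (pos_INR (S n)).
      field. split; [apply INR_fact_neq_0 | lra].
  - apply CV_radius_inside. rewrite sk_radius. exact I.
  - apply ex_pseries_scal; [apply Rmult_comm|].
    apply ex_pseries_incr_1, CV_radius_inside.
    rewrite CV_radius_derive, sk_radius. exact I.
Qed.

Lemma Ck_0 : Ck 0 = 1.
Proof. unfold Ck. rewrite PSeries_0. unfold ck_coef. simpl. field. Qed.

(** [cos_prop k] and [sin_prop k] are the solutions of [f'' = - k f] with
    [(f, f')] equal to [(1, 0)] and [(0, 1)] at 0, for [k] of any sign. *)
Definition cos_prop (k x : R) : R := Ck (- (k * x ^ 2)).
Definition sin_prop (k x : R) : R := x * Sk (- (k * x ^ 2)).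

Lemma cos_prop_derive (k x : R) :
  is_derive (cos_prop k) x (- k * sin_prop k x).
Proof.
  evar_last.
  - apply (is_derive_comp Ck (fun x => - (k * x ^ 2))); [apply Ck_derive|].
    auto_derive; [exact I | reflexivity].
  - unfold sin_prop. change (scal ?x ?y) with (x * y). field.
Qed.

Lemma sin_prop_derive (k x : R) : is_derive (sin_prop k) x (cos_prop k x).
Proof.
  evar_last.
  - apply (is_derive_mult (fun x : R => x) (fun x => Sk (- (k * x ^ 2)))).
    + apply is_derive_id.
    + apply (is_derive_comp Sk (fun x => - (k * x ^ 2))); [apply Sk_derive|].
      auto_derive; [exact I | reflexivity].
    + intros; apply Rmult_comm.
  - unfold cos_prop. rewrite <- Sk_dSk. change (scal ?x ?y) with (x * y).
    change (plus ?x ?y) with (x + y). change (mult ?x ?y) with (x * y).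
    change one with 1. ring.
Qed.

Lemma cos_prop_0 (k : R) : cos_prop k 0 = 1.
Proof.
  unfold cos_prop. replace (- (k * 0 ^ 2)) with 0 by ring. apply Ck_0.
Qed.

Lemma sin_prop_0 (k : R) : sin_prop k 0 = 0.
Proof. unfold sin_prop. ring. Qed.

(** * Flow in a homogeneous particle *)

(** Flow over a length [x] of the system [u' = e q], [q' = - m u], on data
    [y = (u, q)]. *)
Definition flow (e m x : R) (y : R * R) : R * R :=
  (cos_prop (e * m) x * fst y + e * sin_prop (e * m) x * snd y,
   - m * sin_prop (e * m) x * fst y + cos_prop (e * m) x * snd y).

Lemma flow_0 (e m : R) (y : R * R) : flow e m 0 y = y.
Proof.
  unfold flow. rewrite cos_prop_0, sin_prop_0. destruct y; simpl. f_equal; ring.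
Qed.

Lemma is_derive_mult_const (f : R -> R) (x d c : R) :
  is_derive f x d -> is_derive (fun x => f x * c) x (d * c).
Proof.
  intros h. apply (is_derive_ext (fun x => c * f x)).
  - intros; apply Rmult_comm.
  - evar_last; [apply is_derive_scal, h | apply Rmult_comm].
Qed.

Lemma flow_derive_fst (e m : R) (y : R * R) (x : R) :
  is_derive (fun x => fst (flow e m x y)) x (e * snd (flow e m x y)).
Proof.
  unfold flow; simpl. evar_last.
  - apply (is_derive_plus (fun x => cos_prop (e * m) x * fst y)
      (fun x => e * sin_prop (e * m) x * snd y)).
    + apply is_derive_mult_const, cos_prop_derive.
    + apply (is_derive_mult_const (fun x => e * sin_prop (e * m) x)).
      apply is_derive_scal, sin_prop_derive.
  - change (plus ?x ?y) with (x + y). ring.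
Qed.

Lemma flow_derive_snd (e m : R) (y : R * R) (x : R) :
  is_derive (fun x => snd (flow e m x y)) x (- m * fst (flow e m x y)).
Proof.
  unfold flow; simpl. evar_last.
  - apply (is_derive_plus (fun x => - m * sin_prop (e * m) x * fst y)
      (fun x => cos_prop (e * m) x * snd y)).
    + apply (is_derive_mult_const (fun x => - m * sin_prop (e * m) x)).
      apply is_derive_scal, sin_prop_derive.
    + apply is_derive_mult_const, cos_prop_derive.
  - change (plus ?x ?y) with (x + y). ring.
Qed.

(** * Monotonicity off a finite set *)

Lemma nondecreasing_off_finite (l : list R) (f df : R -> R) (a b : R) :
  a <= b ->
  (forall x, a <= x <= b -> continuous f x) ->
  (forall x, a < x < b -> ~ In x l -> is_derive f x (df x) /\ 0 <= df x) ->
  f a <= f b.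
Proof.
  revert a b. induction l as [|p l IH]; intros a b hab hc hd.
  - destruct (Rle_lt_or_eq_dec _ _ hab) as [hlt| ->]; [|lra].
    (* the mean value point may be an end point, where [df] is unconstrained *)
    pose (dg := fun x => if Rlt_dec a x then
                           if Rlt_dec x b then df x else 0 else 0).
    assert (hg : forall x, 0 <= dg x).
    { intros x; unfold dg. destruct (Rlt_dec a x); [|lra].
      destruct (Rlt_dec x b); [|lra]. apply hd; [lra | intros []]. }
    destruct (MVT_gen f a b dg) as [c [hc1 hc2]].
    + intros x hx. rewrite Rmin_left, Rmax_right in hx by lra.
      unfold dg. destruct (Rlt_dec a x); [|lra]. destruct (Rlt_dec x b); [|lra].
      apply hd; [lra | intros []].
    + intros x hx. rewrite Rmin_left, Rmax_right in hx by lra.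
      apply continuity_pt_filterlim, hc, hx.
    + specialize (hg c). nra.
  - destruct (Rlt_dec a p) as [h1|h1]; [destruct (Rlt_dec p b) as [h2|h2]|].
    + apply Rle_trans with (f p).
      * apply IH; [lra | intros; apply hc; lra |].
        intros x hx hn. apply hd; [lra | intros [e|h]; [lra | tauto]].
      * apply IH; [lra | intros; apply hc; lra |].
        intros x hx hn. apply hd; [lra | intros [e|h]; [lra | tauto]].
    + apply IH; [lra | assumption |].
      intros x hx hn. apply hd; [lra | intros [e|h]; [lra | tauto]].
    + apply IH; [lra | assumption |].
      intros x hx hn. apply hd; [lra | intros [e|h]; [lra | tauto]].
Qed.

Lemma constant_off_finite (l : list R) (f : R -> R) (a b : R) :
  a <= b ->
  (forall x, a <= x <= b -> continuous f x) ->
  (forall x, a < x < b -> ~ In x l -> is_derive f x 0) ->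
  f a = f b.
Proof.
  intros hab hc hd. apply Rle_antisym.
  - apply (nondecreasing_off_finite l f (fun _ => 0)); auto.
    intros; split; [auto | lra].
  - apply Ropp_le_cancel.
    apply (nondecreasing_off_finite l (fun x => - f x) (fun _ => 0)); auto.
    + intros x hx. apply (continuous_opp f), hc, hx.
    + intros x hx hn; split; [|lra]. evar_last.
      * apply (is_derive_opp f), (hd x hx hn).
      * apply Ropp_0.
Qed.

(** * Conservation of the Wronskian *)

(** Wronskian [v q - u p] of two data [(u, q)] and [(v, p)] made of a value and
    a flux. *)
Definition wronskian (y z : R * R) : R := fst z * snd y - fst y * snd z.

Lemma continuous_of_derive (f : R -> R) (x d : R) :
  is_derive f x d -> continuous f x.
Proof. intros h. apply (ex_derive_continuous f). exists d. exact h. Qed.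

Lemma flow_wronskian (e m x : R) (y z : R * R) :
  wronskian (flow e m x y) (flow e m x z) = wronskian y z.
Proof.
  assert (h : cos_prop (e * m) x ^ 2 + e * m * sin_prop (e * m) x ^ 2 = 1).
  { pose (f := fun x => cos_prop (e * m) x * cos_prop (e * m) x
                  + e * m * (sin_prop (e * m) x * sin_prop (e * m) x)).
    assert (hd : forall x, is_derive f x 0).
    { intros t. evar_last.
      - apply (is_derive_plus (fun x => cos_prop (e * m) x * cos_prop (e * m) x)).
        + apply (is_derive_mult (cos_prop (e * m)) (cos_prop (e * m)));
            [apply cos_prop_derive .. | intros; apply Rmult_comm].
        + apply is_derive_scal.
          apply (is_derive_mult (sin_prop (e * m)) (sin_prop (e * m)));
            [apply sin_prop_derive .. | intros; apply Rmult_comm].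
      - unfold plus, mult; simpl. ring. }
    assert (h0 : f 0 = 1).
    { unfold f. rewrite cos_prop_0, sin_prop_0. ring. }
    assert (hx : f x = f 0).
    { destruct (Rle_dec 0 x).
      - symmetry. apply (constant_off_finite nil); auto.
        intros t _. apply (continuous_of_derive f t 0), hd.
      - apply (constant_off_finite nil); auto; [lra|].
        intros t _. apply (continuous_of_derive f t 0), hd. }
    rewrite <- h0, <- hx. unfold f. ring. }
  unfold wronskian, flow; simpl.
  transitivity ((fst z * snd y - fst y * snd z) *
    (cos_prop (e * m) x ^ 2 + e * m * sin_prop (e * m) x ^ 2)); [ring|].
  rewrite h. ring.
Qed.

(** * The unit cell *)

Lemma node_lt (M : unit_cell) (i j : nat) :
  (i < j)%nat -> (j <= 2 * cell_N M + 1)%nat -> node M i < node M j.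
Proof.
  induction 1 as [|j hij IH]; intros hj.
  - apply node_increasing; lia.
  - apply Rlt_trans with (node M j); [apply IH; lia|].
    apply node_increasing; lia.
Qed.

Lemma node_le (M : unit_cell) (i j : nat) :
  (i <= j)%nat -> (j <= 2 * cell_N M + 1)%nat -> node M i <= node M j.
Proof.
  intros h hj. destruct (Nat.eq_dec i j) as [->|]; [lra|].
  left; apply node_lt; lia.
Qed.

Lemma node_range (M : unit_cell) (i : nat) :
  (i <= 2 * cell_N M + 1)%nat -> 0 <= node M i <= 1.
Proof.
  intros h. split.
  - rewrite <- (node_first M). apply node_le; lia.
  - rewrite <- (node_last M). apply node_le; lia.
Qed.

Lemma node_locate (M : unit_cell) (t : R) (J : nat) :
  0 <= t < node M J -> exists j, (j < J)%nat /\ node M j <= t < node M (S j).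
Proof.
  induction J as [|J IH]; intros h.
  - rewrite node_first in h. lra.
  - destruct (Rlt_dec t (node M J)) as [hlt|hge].
    + destruct IH as [j [hj h']]; [lra|]. exists j. split; [lia | exact h'].
    + exists J. split; [lia | lra].
Qed.

(** Permittivity of the [j]-th particle of the cell, counted from 0 regardless
    of its kind. *)
Definition particle_eps (e1 e2 : R) (j : nat) : R := if Nat.even j then e1 else e2.

(** Permittivity profile at a fixed frequency, with [e1], [e2] the values of
    the two permittivities there. *)
Definition medium (M : unit_cell) (e1 e2 x : R) : R :=
  if excluded_middle_informative (in_first_particle M x) then e1 else e2.

Lemma IZR_close_eq (k k' : Z) : Rabs (IZR k - IZR k') < 1 -> k = k'.
Proof.
  rewrite <- minus_IZR, <- abs_IZR. intros h. apply lt_IZR in h. lia.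
Qed.

Lemma medium_particle (M : unit_cell) (e1 e2 x : R) (k : Z) (j : nat) :
  (j < 2 * cell_N M + 1)%nat -> node M j < x - IZR k < node M (S j) ->
  medium M e1 e2 x = particle_eps e1 e2 j.
Proof.
  intros hj hx. unfold medium, particle_eps.
  pose proof (node_range M j ltac:(lia)).
  pose proof (node_range M (S j) ltac:(lia)).
  destruct excluded_middle_informative as [h|h]; destruct (Nat.even j) eqn:he; auto.
  - exfalso. destruct h as [k' [i [hi h]]].
    pose proof (node_range M (2 * i) ltac:(lia)).
    pose proof (node_range M (2 * i + 1) ltac:(lia)).
    assert (k = k') as <- by (apply IZR_close_eq, Rabs_def1; lra).
    assert (~ (S j <= 2 * i)%nat).
    { intros hn. pose proof (node_le M (S j) (2 * i) hn ltac:(lia)). lra. }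
    assert (~ (2 * i + 1 <= j)%nat).
    { intros hn. pose proof (node_le M (2 * i + 1) j hn ltac:(lia)). lra. }
    replace j with (2 * i)%nat in he by lia.
    rewrite Nat.even_mul in he. discriminate.
  - exfalso. apply h. apply Nat.even_spec in he. destruct he as [i ->].
    exists k, i. split; [lia|]. replace (2 * i + 1)%nat with (S (2 * i)) by lia. lra.
Qed.

Lemma not_interface_locate (M : unit_cell) (x : R) (k : Z) :
  ~ interface M x -> IZR k <= x < IZR k + 1 ->
  exists j, (j < 2 * cell_N M + 1)%nat /\ node M j < x - IZR k < node M (S j).
Proof.
  intros hn hx.
  destruct (node_locate M (x - IZR k) (2 * cell_N M + 1)) as [j [hj h]].
  { rewrite node_last. lra. }
  exists j. split; [exact hj|].
  destruct (Rle_lt_or_eq_dec _ _ (proj1 h)) as [hlt|he]; [lra|].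
  exfalso. apply hn. exists k, j. split; [lia | lra].
Qed.

(** Data at [node j] of the solution with data [y] at the left end of the cell. *)
Fixpoint transfer (M : unit_cell) (e1 e2 m : R) (j : nat) (y : R * R) : R * R :=
  match j with
  | O => y
  | S i => flow (particle_eps e1 e2 i) m (node M (S i) - node M i)
             (transfer M e1 e2 m i y)
  end.

(** Solution with data [y] at 0, in the medium that agrees with the cell up to
    [node j] and is continued by the [j]-th particle after [node j], and by the
    first one before 0. *)
Fixpoint cell_state (M : unit_cell) (e1 e2 m : R) (j : nat) (y : R * R) (x : R)
  : R * R :=
  match j with
  | O => flow (particle_eps e1 e2 0) m x y
  | S i => if Rle_dec x (node M (S i)) then cell_state M e1 e2 m i y x
           else flow (particle_eps e1 e2 (S i)) m (x - node M (S i))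
                  (transfer M e1 e2 m (S i) y)
  end.

(** Linear combination [s y + t z] of data. *)
Definition lin (s : R) (y : R * R) (t : R) (z : R * R) : R * R :=
  (s * fst y + t * fst z, s * snd y + t * snd z).

Lemma flow_lin (e m x s t : R) (y z : R * R) :
  flow e m x (lin s y t z) = lin s (flow e m x y) t (flow e m x z).
Proof. unfold flow, lin; simpl. f_equal; ring. Qed.

Lemma transfer_lin (M : unit_cell) (e1 e2 m s t : R) (y z : R * R) (j : nat) :
  transfer M e1 e2 m j (lin s y t z) =
  lin s (transfer M e1 e2 m j y) t (transfer M e1 e2 m j z).
Proof.
  induction j as [|j IH]; simpl; [reflexivity|]. rewrite IH. apply flow_lin.
Qed.

Lemma cell_state_lin (M : unit_cell) (e1 e2 m s t x : R) (y z : R * R) (j : nat) :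
  cell_state M e1 e2 m j (lin s y t z) x =
  lin s (cell_state M e1 e2 m j y x) t (cell_state M e1 e2 m j z x).
Proof.
  induction j as [|j IH]; simpl.
  - apply flow_lin.
  - destruct Rle_dec; [exact IH|]. rewrite transfer_lin. rewrite !flow_lin. reflexivity.
Qed.

Lemma transfer_wronskian (M : unit_cell) (e1 e2 m : R) (y z : R * R) (j : nat) :
  wronskian (transfer M e1 e2 m j y) (transfer M e1 e2 m j z) = wronskian y z.
Proof.
  induction j as [|j IH]; simpl; [reflexivity|]. rewrite flow_wronskian. exact IH.
Qed.

Lemma cell_state_left (M : unit_cell) (e1 e2 m x : R) (y : R * R) (j : nat) :
  (j <= 2 * cell_N M)%nat -> x <= node M 1 ->
  cell_state M e1 e2 m j y x = flow e1 m x y.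
Proof.
  intros hj hx. induction j as [|j IH]; simpl; [reflexivity|].
  destruct Rle_dec as [h|h]; [apply IH; lia|].
  pose proof (node_le M 1 (S j) ltac:(lia) ltac:(lia)). lra.
Qed.

Lemma cell_state_right (M : unit_cell) (e1 e2 m x : R) (y : R * R) (j : nat) :
  (j <= 2 * cell_N M)%nat -> node M j <= x ->
  cell_state M e1 e2 m j y x =
  flow (particle_eps e1 e2 j) m (x - node M j) (transfer M e1 e2 m j y).
Proof.
  revert x. induction j as [|j IH]; intros x hj hx.
  - simpl. rewrite node_first, Rminus_0_r. reflexivity.
  - cbn [cell_state]. destruct Rle_dec as [h|h]; [|reflexivity].
    assert (x = node M (S j)) as -> by lra.
    rewrite IH; [|lia | apply node_le; lia].
    rewrite Rminus_diag, flow_0. reflexivity.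
Qed.

Lemma cell_state_0 (M : unit_cell) (e1 e2 m : R) (y : R * R) (j : nat) :
  (j <= 2 * cell_N M)%nat -> cell_state M e1 e2 m j y 0 = y.
Proof.
  intros hj. rewrite cell_state_left; [apply flow_0 | exact hj|].
  apply node_range; lia.
Qed.

Lemma glue_derive (f g : R -> R) (c x d : R) :
  f c = g c -> (x <= c -> is_derive f x d) -> (c <= x -> is_derive g x d) ->
  is_derive (fun x => if Rle_dec x c then f x else g x) x d.
Proof.
  intros hc hf hg. destruct (Rtotal_order x c) as [h|[->|h]].
  - apply (is_derive_ext_loc f); [|apply hf; lra].
    apply (locally_interval _ x m_infty c); simpl; auto.
    intros y _ hy. destruct Rle_dec; [reflexivity | lra].
  - apply (extension_cont_is_derive f g); [apply hf | apply hg | exact hc]; lra.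
  - apply (is_derive_ext_loc g); [|apply hg; lra].
    apply (locally_interval _ x c p_infty); simpl; auto.
    intros y hy _. destruct Rle_dec; [lra | reflexivity].
Qed.

Lemma glue_continuous (f g : R -> R) (c x : R) :
  f c = g c -> (x <= c -> continuous f x) -> (c <= x -> continuous g x) ->
  continuous (fun x => if Rle_dec x c then f x else g x) x.
Proof.
  intros hc hf hg. destruct (Rtotal_order x c) as [h|[->|h]].
  - apply (continuous_ext_loc _ f); [|apply hf; lra].
    apply (locally_interval _ x m_infty c); simpl; auto.
    intros y _ hy. destruct Rle_dec; [reflexivity | lra].
  - apply (extension_cont_continuous f g); [apply hf | apply hg | exact hc]; lra.
  - apply (continuous_ext_loc _ g); [|apply hg; lra].
    apply (locally_interval _ x c p_infty); simpl; auto.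
    intros y hy _. destruct Rle_dec; [lra | reflexivity].
Qed.

Lemma is_derive_shift (f : R -> R) (c x d : R) :
  is_derive f (x - c) d -> is_derive (fun x => f (x - c)) x d.
Proof.
  intros h. evar_last.
  - apply (is_derive_comp f (fun x => x - c)); [exact h|].
    auto_derive; [exact I | reflexivity].
  - apply Rmult_1_l.
Qed.

Lemma continuous_shift (f : R -> R) (c x : R) :
  continuous f (x - c) -> continuous (fun x => f (x - c)) x.
Proof.
  intros h. apply (continuous_comp (fun x => x - c) f); [|exact h].
  apply (continuous_of_derive _ x 1). auto_derive; [exact I | ring].
Qed.

Lemma cell_state_glue (M : unit_cell) (e1 e2 m : R) (y : R * R) (j : nat) :
  (S j <= 2 * cell_N M)%nat ->
  cell_state M e1 e2 m j y (node M (S j)) =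
  flow (particle_eps e1 e2 (S j)) m (node M (S j) - node M (S j))
    (transfer M e1 e2 m (S j) y).
Proof.
  intros hj. rewrite cell_state_right; [|lia | apply node_le; lia].
  rewrite Rminus_diag, flow_0. reflexivity.
Qed.

Lemma cell_state_flux_derive (M : unit_cell) (e1 e2 m : R) (y : R * R)
  (j : nat) (x : R) : (j <= 2 * cell_N M)%nat ->
  is_derive (fun x => snd (cell_state M e1 e2 m j y x)) x
    (- m * fst (cell_state M e1 e2 m j y x)).
Proof.
  induction j as [|j IH]; intros hj; [apply flow_derive_snd|].
  apply (is_derive_ext (fun x => if Rle_dec x (node M (S j))
    then snd (cell_state M e1 e2 m j y x)
    else snd (flow (particle_eps e1 e2 (S j)) m (x - node M (S j))
                (transfer M e1 e2 m (S j) y)))).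
  { intros t. cbn [cell_state]. destruct Rle_dec; reflexivity. }
  apply glue_derive.
  - f_equal. apply cell_state_glue, hj.
  - intros hx. cbn [cell_state]. destruct Rle_dec; [|lra]. apply IH; lia.
  - intros hx. rewrite (cell_state_right M e1 e2 m x y (S j)); auto.
    apply (is_derive_shift (fun x => snd (flow _ _ x _))), flow_derive_snd.
Qed.

Lemma cell_state_continuous (M : unit_cell) (e1 e2 m : R) (y : R * R)
  (j : nat) (x : R) : (j <= 2 * cell_N M)%nat ->
  continuous (fun x => fst (cell_state M e1 e2 m j y x)) x.
Proof.
  induction j as [|j IH]; intros hj.
  - eapply continuous_of_derive, flow_derive_fst.
  - apply (continuous_ext (fun x => if Rle_dec x (node M (S j))
      then fst (cell_state M e1 e2 m j y x)
      else fst (flow (particle_eps e1 e2 (S j)) m (x - node M (S j))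
                  (transfer M e1 e2 m (S j) y)))).
    { intros t. cbn [cell_state]. destruct Rle_dec; reflexivity. }
    apply glue_continuous.
    + f_equal. apply cell_state_glue, hj.
    + intros _. apply IH; lia.
    + intros _. apply (continuous_shift (fun x => fst (flow _ _ x _))).
      eapply continuous_of_derive, flow_derive_fst.
Qed.

(** For [i = j] there is no upper bound on [x]. *)
Lemma cell_state_value_derive (M : unit_cell) (e1 e2 m : R) (y : R * R)
  (j i : nat) (x : R) : (j <= 2 * cell_N M)%nat ->
  (i <= j)%nat -> node M i < x -> ((i < j)%nat -> x < node M (S i)) ->
  is_derive (fun x => fst (cell_state M e1 e2 m j y x)) x
    (particle_eps e1 e2 i * snd (cell_state M e1 e2 m j y x)).
Proof.
  induction j as [|j IH]; intros hj hi hx hx'.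
  - replace i with 0%nat by lia. apply flow_derive_fst.
  - destruct (Nat.eq_dec i (S j)) as [->|hne].
    + rewrite cell_state_right; [|auto | lra].
      apply (is_derive_ext_loc (fun x => fst (flow (particle_eps e1 e2 (S j)) m
         (x - node M (S j)) (transfer M e1 e2 m (S j) y)))).
      * apply (locally_interval _ x (node M (S j)) p_infty); simpl; auto.
        intros t ht _. destruct Rle_dec; [lra | reflexivity].
      * apply (is_derive_shift (fun x => fst (flow _ _ x _))), flow_derive_fst.
    + specialize (hx' ltac:(lia)).
      assert (h1 : node M (S i) <= node M (S j)) by (apply node_le; lia).
      apply (is_derive_ext_loc (fun x => fst (cell_state M e1 e2 m j y x))).
      * apply (locally_interval _ x m_infty (node M (S j))); simpl; auto; [lra|].
        intros t _ ht. destruct Rle_dec; [reflexivity | lra].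
      * cbn [cell_state]. destruct Rle_dec; [|lra].
        apply IH; try lia; auto.
Qed.

(** Data at 1 of the solution with data [y] at 0. *)
Definition monodromy (M : unit_cell) (e1 e2 m : R) (y : R * R) : R * R :=
  transfer M e1 e2 m (2 * cell_N M + 1) y.

(** Solution over the whole cell.  It is continued on both sides by particles of
    the first kind, as in the periodic medium, so that consecutive cells can be
    glued. *)
Definition cell_solution (M : unit_cell) (e1 e2 m : R) (y : R * R) (x : R) : R * R :=
  cell_state M e1 e2 m (2 * cell_N M) y x.

Lemma cell_solution_1 (M : unit_cell) (e1 e2 m : R) (y : R * R) :
  cell_solution M e1 e2 m y 1 = monodromy M e1 e2 m y.
Proof.
  unfold cell_solution, monodromy.
  rewrite cell_state_right; auto.
  - rewrite <- (node_last M). replace (2 * cell_N M + 1)%nat with (S (2 * cell_N M)) by lia.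
    reflexivity.
  - apply node_range; lia.
Qed.

(** * Solutions on the whole line *)

(** [solution] at a fixed frequency for real functions, in first-order form:
    [e1], [e2] are the permittivities, [m] is [mu0 w^2] and [q] the flux. *)
Definition is_sol (M : unit_cell) (e1 e2 m : R) (I : R -> Prop) (u q : R -> R)
  : Prop :=
  (forall x, I x -> continuous u x) /\
  (forall x, I x -> ~ interface M x -> is_derive u x (medium M e1 e2 x * q x)) /\
  (forall x, I x -> is_derive q x (- m * u x)).

(** Function glued from the cell solutions; [c k] is the data at the integer [k].
    It is a solution when [c] is an orbit of the monodromy. *)
Definition line_solution (M : unit_cell) (e1 e2 m : R) (c : Z -> R * R) (x : R)
  : R * R :=
  cell_solution M e1 e2 m (c (Zfloor x)) (x - IZR (Zfloor x)).

Lemma line_solution_on (M : unit_cell) (e1 e2 m : R) (c : Z -> R * R) (k : Z) (x : R) :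
  (forall k, c (k + 1)%Z = monodromy M e1 e2 m (c k)) ->
  IZR k <= x <= IZR k + 1 ->
  line_solution M e1 e2 m c x = cell_solution M e1 e2 m (c k) (x - IZR k).
Proof.
  intros hc hx. unfold line_solution.
  destruct (Rlt_dec x (IZR k + 1)) as [h|h].
  - rewrite (Zfloor_eq k); [reflexivity | lra].
  - assert (x = IZR (k + 1)) as -> by (rewrite plus_IZR; lra).
    rewrite ZfloorZ, Rminus_diag, hc, plus_IZR.
    replace (IZR k + 1 - IZR k) with 1 by ring.
    rewrite cell_solution_1. apply cell_state_0. lia.
Qed.

Lemma line_solution_is_sol (M : unit_cell) (e1 e2 m : R) (c : Z -> R * R) :
  (forall k, c (k + 1)%Z = monodromy M e1 e2 m (c k)) ->
  is_sol M e1 e2 m (fun _ => True) (fun x => fst (line_solution M e1 e2 m c x))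
    (fun x => snd (line_solution M e1 e2 m c x)).
Proof.
  intros hc.
  assert (hcase : forall x, exists k, IZR k <= x < IZR k + 1)
    by (intros x; exists (Zfloor x); apply Zfloor_bound).
  (* near an integer the solution is glued from the cells on both sides *)
  assert (hglue : forall k (p : R * R -> R),
    locally (IZR k) (fun t =>
      (if Rle_dec t (IZR k)
       then p (cell_solution M e1 e2 m (c (k - 1)%Z) (t - IZR (k - 1)))
       else p (cell_solution M e1 e2 m (c k) (t - IZR k))) =
      p (line_solution M e1 e2 m c t))).
  { intros k p. apply (locally_interval _ _ (IZR k - 1) (IZR k + 1)); simpl; try lra.
    intros t h1 h2. destruct Rle_dec.
    - rewrite (line_solution_on M e1 e2 m c (k - 1)); auto; rewrite minus_IZR; lra.
    - rewrite (line_solution_on M e1 e2 m c k); auto; lra. }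
  assert (heq : forall k (p : R * R -> R),
    p (cell_solution M e1 e2 m (c (k - 1)%Z) (IZR k - IZR (k - 1))) =
    p (cell_solution M e1 e2 m (c k) (IZR k - IZR k))).
  { intros k p. rewrite minus_IZR.
    replace (IZR k - (IZR k - 1)) with 1 by ring.
    rewrite cell_solution_1, <- hc, Rminus_diag.
    replace (k - 1 + 1)%Z with k by lia. f_equal. symmetry. apply cell_state_0. lia. }
  assert (hloc : forall k (p : R * R -> R) x, IZR k < x < IZR k + 1 ->
    locally x (fun t => p (cell_solution M e1 e2 m (c k) (t - IZR k)) =
      p (line_solution M e1 e2 m c t))).
  { intros k p x hx. apply (locally_interval _ _ (IZR k) (IZR k + 1)); simpl; try lra.
    intros t h1 h2. rewrite (line_solution_on M e1 e2 m c k); auto; lra. }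
  split; [|split].
  - intros x _. destruct (hcase x) as [k hk].
    destruct (Rle_lt_or_eq_dec _ _ (proj1 hk)) as [hlt|<-].
    + eapply continuous_ext_loc; [apply (hloc k fst x); lra|].
      apply (continuous_shift (fun x => fst (cell_solution _ _ _ _ _ x))).
      apply cell_state_continuous; lia.
    + eapply continuous_ext_loc; [apply (hglue k fst)|].
      apply glue_continuous; [apply (heq k fst) | intros _ ..];
      apply (continuous_shift (fun x => fst (cell_solution _ _ _ _ _ x)));
      apply cell_state_continuous; lia.
  - intros x _ hx. destruct (hcase x) as [k hk].
    destruct (not_interface_locate M x k hx hk) as [j [hj hxj]].
    pose proof (node_range M j ltac:(lia)).
    pose proof (node_range M (S j) ltac:(lia)).
    rewrite (medium_particle M e1 e2 x k j); auto.
    rewrite (line_solution_on M e1 e2 m c k); [|exact hc|lra].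
    eapply is_derive_ext_loc; [apply (hloc k fst x); lra|].
    apply (is_derive_shift (fun x => fst (cell_solution _ _ _ _ _ x))).
    apply cell_state_value_derive; try lia; try lra.
  - intros x _. destruct (hcase x) as [k hk].
    destruct (Rle_lt_or_eq_dec _ _ (proj1 hk)) as [hlt|<-].
    + eapply is_derive_ext_loc; [apply (hloc k snd x); lra|].
      rewrite (line_solution_on M e1 e2 m c k); [|exact hc|lra].
      apply (is_derive_shift (fun x => snd (cell_solution _ _ _ _ _ x))).
      apply cell_state_flux_derive; lia.
    + eapply is_derive_ext_loc; [apply (hglue k snd)|].
      apply glue_derive; [apply (heq k snd) | intros _ ..].
      * rewrite (line_solution_on M e1 e2 m c k); [|exact hc|lra]. rewrite <- (heq k fst).
        apply (is_derive_shift (fun x => snd (cell_solution _ _ _ _ _ x))).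
        apply cell_state_flux_derive; lia.
      * rewrite (line_solution_on M e1 e2 m c k); [|exact hc|lra].
        apply (is_derive_shift (fun x => snd (cell_solution _ _ _ _ _ x))).
        apply cell_state_flux_derive; lia.
Qed.

(** * Wronskians and complex solutions *)

Lemma interface_finite (M : unit_cell) (x y : R) :
  exists l : list R, forall z, x <= z <= y -> interface M z -> In z l.
Proof.
  exists (flat_map (fun n => map (fun i => IZR (Zfloor x - 1 + Z.of_nat n) + node M i)
    (seq 0 (2 * cell_N M + 2))) (seq 0 (Z.to_nat (Zfloor y - Zfloor x + 3)))).
  intros z hz [k [i [hi ->]]].
  pose proof (node_range M i hi).
  pose proof (Zfloor_bound x). pose proof (Zfloor_bound y).
  assert (hk1 : (Zfloor x - 1 <= k)%Z).
  { apply Z.lt_succ_r, lt_IZR. unfold Z.succ. rewrite plus_IZR, minus_IZR. lra. }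
  assert (hk2 : (k <= Zfloor y)%Z).
  { apply Z.lt_succ_r, lt_IZR. unfold Z.succ. rewrite plus_IZR. lra. }
  apply in_flat_map. exists (Z.to_nat (k - Zfloor x + 1)). split.
  - apply in_seq. lia.
  - apply in_map_iff. exists i. split; [|apply in_seq; lia].
    f_equal. f_equal. lia.
Qed.

Lemma is_sol_wronskian (M : unit_cell) (e1 e2 m : R) (I : R -> Prop)
  (u q v p : R -> R) (x y : R) :
  is_sol M e1 e2 m I u q -> is_sol M e1 e2 m I v p ->
  (forall z, x <= z <= y -> I z) -> x <= y ->
  wronskian (u x, q x) (v x, p x) = wronskian (u y, q y) (v y, p y).
Proof.
  intros [hu [hu' hq']] [hv [hv' hp']] hI hxy.
  destruct (interface_finite M x y) as [l hl].
  unfold wronskian; cbn [fst snd].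
  apply (constant_off_finite l (fun x => v x * q x - u x * p x)); auto.
  - intros z hz. specialize (hI z hz).
    apply (continuous_minus (fun x => v x * q x) (fun x => u x * p x)).
    + apply (continuous_mult v q); auto. eapply continuous_of_derive; auto.
    + apply (continuous_mult u p); auto. eapply continuous_of_derive; auto.
  - intros z hz hn.
    assert (hz' : x <= z <= y) by lra. specialize (hI z hz').
    assert (hni : ~ interface M z) by (intros h; apply hn, hl; auto).
    evar_last.
    + apply (is_derive_minus (fun x => v x * q x) (fun x => u x * p x)).
      * apply (is_derive_mult v q); auto; intros; apply Rmult_comm.
      * apply (is_derive_mult u p); auto; intros; apply Rmult_comm.
    + unfold minus, plus, opp, mult; simpl. ring.
Qed.

Lemma solution_is_sol (mu0 : R) (eps1 eps2 : R -> R) (M : unit_cell) (w : R)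
  (I : R -> Prop) (u : R -> R) :
  0 < mu0 -> eps1 w <> 0 -> eps2 w <> 0 ->
  solution mu0 eps1 eps2 M w I u ->
  exists q, is_sol M (eps1 w) (eps2 w) (mu0 * w ^ 2) I u q.
Proof.
  intros hmu h1 h2 [q [hu [hu' hq']]]. exists q. split; [|split]; auto.
  - intros x hx hn. destruct (hu' x hx hn) as [du [hd hq]].
    change (@eq R (q x) (/ medium M (eps1 w) (eps2 w) x * du)) in hq.
    replace (medium M (eps1 w) (eps2 w) x * q x) with (du : R); auto.
    rewrite hq, <- Rmult_assoc, Rinv_r, Rmult_1_l; [reflexivity|].
    unfold medium. destruct excluded_middle_informative; auto.
  - intros x hx. destruct (hq' x hx) as [dq [hd hq]].
    change (@eq R (- / mu0 * dq) (w ^ 2 * u x)) in hq.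
    replace (- (mu0 * w ^ 2) * u x) with (dq : R); auto.
    rewrite Ropp_mult_distr_l_reverse, Rmult_assoc, <- hq, <- Rmult_assoc.
    rewrite Ropp_mult_distr_r_reverse, Rinv_r by lra.
    rewrite Ropp_mult_distr_l_reverse, Ropp_involutive, Rmult_1_l. reflexivity.
Qed.

Lemma is_sol_solution (mu0 : R) (eps1 eps2 : R -> R) (M : unit_cell) (w : R)
  (I : R -> Prop) (u q : R -> R) :
  0 < mu0 -> eps1 w <> 0 -> eps2 w <> 0 ->
  is_sol M (eps1 w) (eps2 w) (mu0 * w ^ 2) I u q ->
  solution mu0 eps1 eps2 M w I u.
Proof.
  intros hmu h1 h2 [hu [hu' hq']]. exists q. split; [|split]; auto.
  - intros x hx hn. eexists; split; [apply hu'; auto|].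
    change (@eq R (q x) (/ medium M (eps1 w) (eps2 w) x *
      (medium M (eps1 w) (eps2 w) x * q x))).
    field. unfold medium. destruct excluded_middle_informative; auto.
  - intros x hx. eexists; split; [apply hq'; auto|].
    change (@eq R (- / mu0 * (- (mu0 * w ^ 2) * u x)) (w ^ 2 * u x)). field. lra.
Qed.

Lemma is_derive_components (f : R -> C_R_NormedModule) (x : R) (d : C_R_NormedModule) :
  is_derive f x d ->
  is_derive (fun x => fst (f x)) x (fst d) /\ is_derive (fun x => snd (f x)) x (snd d).
Proof.
  intros h. split.
  - apply (filterdiff_comp' f fst x _ fst h).
    apply filterdiff_linear, is_linear_fst.
  - apply (filterdiff_comp' f snd x _ snd h).
    apply filterdiff_linear, is_linear_snd.
Qed.

Lemma is_derive_pair (f g : R -> R) (x df dg : R) :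
  is_derive f x df -> is_derive g x dg ->
  is_derive (fun x => (f x, g x) : C_R_NormedModule) x ((df, dg) : C_R_NormedModule).
Proof.
  intros hf hg.
  apply (is_derive_ext (fun x => plus (scal (f x) ((1, 0) : C_R_NormedModule))
    (scal (g x) ((0, 1) : C_R_NormedModule)))).
  - intros t. unfold plus, scal; simpl. unfold prod_plus, prod_scal; simpl.
    unfold plus, scal; simpl. unfold mult; simpl. f_equal; ring.
  - evar_last.
    + apply (is_derive_plus (fun x => scal (f x) ((1, 0) : C_R_NormedModule))).
      * apply (is_derive_scal_l f), hf.
      * apply (is_derive_scal_l g), hg.
    + unfold plus, scal; simpl. unfold prod_plus, prod_scal; simpl.
      unfold plus, scal; simpl. unfold mult; simpl. f_equal; ring.
Qed.

Lemma continuous_pair (f g : R -> R) (x : R) :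
  continuous f x -> continuous g x ->
  continuous (fun x => (f x, g x) : C_R_NormedModule) x.
Proof.
  intros hf hg.
  apply (continuous_ext (fun x => plus (scal (f x) ((1, 0) : C_R_NormedModule))
    (scal (g x) ((0, 1) : C_R_NormedModule)))).
  - intros t. unfold plus, scal; simpl. unfold prod_plus, prod_scal; simpl.
    unfold plus, scal; simpl. unfold mult; simpl. f_equal; ring.
  - apply (continuous_plus (fun x => scal (f x) ((1, 0) : C_R_NormedModule))).
    + apply (continuous_scal_l f); auto.
    + apply (continuous_scal_l g); auto.
Qed.

Lemma is_sol_solution_C (mu0 : R) (eps1 eps2 : R -> R) (M : unit_cell) (w : R)
  (I : R -> Prop) (u q v p : R -> R) :
  0 < mu0 -> eps1 w <> 0 -> eps2 w <> 0 ->
  is_sol M (eps1 w) (eps2 w) (mu0 * w ^ 2) I u q ->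
  is_sol M (eps1 w) (eps2 w) (mu0 * w ^ 2) I v p ->
  solution mu0 eps1 eps2 M w I (fun x => (u x, v x) : C_R_NormedModule).
Proof.
  intros hmu h1 h2 [hu [hu' hq']] [hv [hv' hp']].
  exists (fun x => (q x, p x)). split; [|split].
  - intros x hx. apply continuous_pair; auto.
  - intros x hx hn. eexists; split; [apply is_derive_pair; auto|].
    change (eps_medium eps1 eps2 M x w) with (medium M (eps1 w) (eps2 w) x).
    unfold scal; simpl. unfold prod_scal; simpl. unfold scal; simpl.
    unfold mult; simpl.
    assert (medium M (eps1 w) (eps2 w) x <> 0)
      by (unfold medium; destruct excluded_middle_informative; auto).
    f_equal; field; auto.
  - intros x hx. eexists; split; [apply is_derive_pair; auto|].
    unfold scal; simpl. unfold prod_scal; simpl. unfold scal; simpl.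
    unfold mult; simpl. f_equal; field; lra.
Qed.

(** * Monodromy matrix *)

(** Entries of the monodromy matrix, with rows [(a, b)] and [(c, d)]. *)
Definition mon_a (M : unit_cell) (e1 e2 m : R) : R := fst (monodromy M e1 e2 m (1, 0)).
Definition mon_b (M : unit_cell) (e1 e2 m : R) : R := fst (monodromy M e1 e2 m (0, 1)).
Definition mon_c (M : unit_cell) (e1 e2 m : R) : R := snd (monodromy M e1 e2 m (1, 0)).
Definition mon_d (M : unit_cell) (e1 e2 m : R) : R := snd (monodromy M e1 e2 m (0, 1)).

Lemma monodromy_matrix (M : unit_cell) (e1 e2 m x y : R) :
  monodromy M e1 e2 m (x, y) =
  (mon_a M e1 e2 m * x + mon_b M e1 e2 m * y,
   mon_c M e1 e2 m * x + mon_d M e1 e2 m * y).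
Proof.
  replace (x, y) with (lin x (1, 0) y (0, 1)) by (unfold lin; simpl; f_equal; ring).
  unfold monodromy at 1. rewrite transfer_lin. unfold lin at 1.
  f_equal; unfold mon_a, mon_b, mon_c, mon_d, monodromy; ring.
Qed.

Lemma monodromy_det (M : unit_cell) (e1 e2 m : R) :
  mon_a M e1 e2 m * mon_d M e1 e2 m - mon_b M e1 e2 m * mon_c M e1 e2 m = 1.
Proof.
  pose proof (transfer_wronskian M e1 e2 m (1, 0) (0, 1) (2 * cell_N M + 1)) as h.
  unfold wronskian in h. cbn [fst snd] in h.
  unfold mon_a, mon_b, mon_c, mon_d, monodromy. lra.
Qed.

Lemma cell_solution_is_sol (M : unit_cell) (e1 e2 m : R) (y : R * R) :
  is_sol M e1 e2 m (fun x => 0 <= x <= 1)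
    (fun x => fst (cell_solution M e1 e2 m y x))
    (fun x => snd (cell_solution M e1 e2 m y x)).
Proof.
  split; [|split].
  - intros x _. apply cell_state_continuous; lia.
  - intros x hx hn.
    assert (x <> 1).
    { intros ->. apply hn. exists 0%Z, (2 * cell_N M + 1)%nat.
      split; [lia|]. rewrite node_last. ring. }
    destruct (not_interface_locate M x 0 hn ltac:(simpl; lra)) as [j [hj hxj]].
    rewrite (medium_particle M e1 e2 x 0 j); auto.
    simpl in hxj. rewrite Rminus_0_r in hxj.
    apply cell_state_value_derive; try lia; try lra.
  - intros x _. apply cell_state_flux_derive; lia.
Qed.

(** Constancy of the Wronskian between one solution and the mirror image of
    another. *)
Lemma mirror_mon_d (M : unit_cell) (e1 e2 m : R) :
  (forall x, 0 <= x <= 1 -> medium M e1 e2 x = medium M e1 e2 (1 - x)) ->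
  mon_d M e1 e2 m = mon_a M e1 e2 m.
Proof.
  intros hsym.
  destruct (cell_solution_is_sol M e1 e2 m (1, 0)) as [hu [hu' hq']].
  destruct (cell_solution_is_sol M e1 e2 m (0, 1)) as [hv [hv' hp']].
  unfold mon_d, mon_a. rewrite <- !cell_solution_1.
  pose proof (cell_state_0 M e1 e2 m (1, 0) (2 * cell_N M) ltac:(lia)) as hu0.
  pose proof (cell_state_0 M e1 e2 m (0, 1) (2 * cell_N M) ltac:(lia)) as hv0.
  fold (cell_solution M e1 e2 m (1, 0) 0) in hu0.
  fold (cell_solution M e1 e2 m (0, 1) 0) in hv0.
  set (Y := cell_solution M e1 e2 m (1, 0)) in *.
  set (Z := cell_solution M e1 e2 m (0, 1)) in *.
  assert (hrev : forall (f : R -> R) x d, is_derive f (1 - x) d ->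
    is_derive (fun x => f (1 - x)) x (- d)).
  { intros f x d h. evar_last.
    - apply (is_derive_comp f (fun x => 1 - x)); [exact h|].
      auto_derive; [exact I | reflexivity].
    - unfold scal; simpl. unfold mult; simpl. ring. }
  assert (hrevc : forall (f : R -> R) x, continuous f (1 - x) ->
    continuous (fun x => f (1 - x)) x).
  { intros f x h. apply (continuous_comp (fun x => 1 - x) f); [|exact h].
    apply (continuous_of_derive _ x (- 1)). auto_derive; [exact I | ring]. }
  destruct (interface_finite M 0 1) as [l hl].
  pose (f := fun x => fst (Y x) * snd (Z (1 - x)) + snd (Y x) * fst (Z (1 - x))).
  assert (hf : f 0 = f 1).
  { apply (constant_off_finite (l ++ map (fun x => 1 - x) l)); [lra| |].
    - intros x hx.
      apply (continuous_plus (fun x => fst (Y x) * snd (Z (1 - x)))).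
      + apply (continuous_mult (fun x => fst (Y x)) (fun x => snd (Z (1 - x)))); auto.
        apply (hrevc (fun x => snd (Z x))). eapply continuous_of_derive, hp'. lra.
      + apply (continuous_mult (fun x => snd (Y x)) (fun x => fst (Z (1 - x)))); auto.
        * eapply continuous_of_derive, hq'. lra.
        * apply (hrevc (fun x => fst (Z x))), hv. lra.
    - intros x hx hn.
      assert (hn1 : ~ interface M x).
      { intros h. apply hn, in_or_app. left. apply hl; auto; lra. }
      (* the mirror image of an interface need not be an interface when [e1 = e2] *)
      assert (hn2 : ~ interface M (1 - x)).
      { intros h. apply hn, in_or_app. right.
        replace x with (1 - (1 - x)) by ring.
        apply (in_map (fun x => 1 - x)), hl; auto; lra. }
      evar_last.
      + apply (is_derive_plus (fun x => fst (Y x) * snd (Z (1 - x)))).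
        * apply (is_derive_mult (fun x => fst (Y x)) (fun x => snd (Z (1 - x)))).
          -- apply hu'; auto; lra.
          -- apply (hrev (fun x => snd (Z x))), hp'; lra.
          -- intros; apply Rmult_comm.
        * apply (is_derive_mult (fun x => snd (Y x)) (fun x => fst (Z (1 - x)))).
          -- apply hq'; lra.
          -- apply (hrev (fun x => fst (Z x))), hv'; auto; lra.
          -- intros; apply Rmult_comm.
      + rewrite <- (hsym x) by lra. unfold plus, mult; simpl. ring. }
  unfold f in hf. rewrite Rminus_0_r, Rminus_diag, hu0, hv0 in hf.
  simpl in hf. lra.
Qed.

Lemma eps_medium_mirror (eps1 eps2 : R -> R) (M : unit_cell) (w : R) :
  mirror_symmetric eps1 eps2 M -> forall x, 0 <= x <= 1 ->
  medium M (eps1 w) (eps2 w) x = medium M (eps1 w) (eps2 w) (1 - x).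
Proof. intros h x hx. exact (h w x hx). Qed.

(** * Band frequencies *)

(** A solution that vanishes identically has zero flux. *)
Lemma is_sol_zero (M : unit_cell) (e1 e2 m : R) (u q : R -> R) :
  e1 <> 0 -> is_sol M e1 e2 m (fun _ => True) u q ->
  (forall x, u x = 0) -> q 0 = 0.
Proof.
  intros h1 [hu [hu' hq']] h0.
  pose proof (node_lt M 0 1 ltac:(lia) ltac:(lia)) as hn.
  rewrite node_first in hn.
  pose (x := node M 1 / 2).
  pose proof (node_range M 1 ltac:(lia)) as hr.
  assert (hx : q x = 0).
  { assert (hni : ~ interface M x).
    { intros [k [i [hi hx]]]. pose proof (node_range M i hi).
      assert (hk : k = 0%Z \/ k = (-1)%Z).
      { assert (k < 1)%Z by (apply lt_IZR; unfold x in hx; lra).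
        assert (-2 < k)%Z by (apply lt_IZR; unfold x in hx; simpl; lra). lia. }
      destruct hk as [-> | ->]; simpl in hx; [|unfold x in hx; lra].
      destruct i as [|i]; [rewrite node_first in hx; unfold x in hx; lra|].
      pose proof (node_le M 1 (S i) ltac:(lia) hi). unfold x in hx; lra. }
    pose proof (is_derive_unique _ _ _ (hu' x Logic.I hni)) as hd.
    rewrite (Derive_ext u (fun _ => 0) x h0), Derive_const in hd.
    rewrite (medium_particle M e1 e2 x 0 0) in hd; [|lia|].
    - unfold particle_eps in hd. simpl in hd. symmetry in hd.
      apply Rmult_integral in hd. tauto.
    - rewrite node_first. simpl. unfold x. lra. }
  transitivity (q x); [|exact hx]. apply (constant_off_finite nil); [unfold x; lra| |].
  - intros t _. eapply continuous_of_derive. apply hq'; exact Logic.I.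
  - intros t _ _. evar_last; [apply hq'; exact Logic.I|].
    rewrite h0. ring.
Qed.

(** For a symmetric cell [a] is half the trace; if [|a| <= 1] the monodromy matrix
    has the eigenvalue [exp (i k)] with [k = acos a]. *)
Lemma band_of_half_trace (mu0 : R) (eps1 eps2 : R -> R) (M : unit_cell) (w : R) :
  0 < mu0 -> eps1 w <> 0 -> eps2 w <> 0 -> mirror_symmetric eps1 eps2 M ->
  Rabs (mon_a M (eps1 w) (eps2 w) (mu0 * w ^ 2)) <= 1 ->
  band_frequency mu0 eps1 eps2 M w.
Proof.
  intros hmu h1 h2 hsym ha.
  pose proof (mirror_mon_d M (eps1 w) (eps2 w) (mu0 * w ^ 2)
    (eps_medium_mirror _ _ M w hsym)) as had.
  pose proof (monodromy_det M (eps1 w) (eps2 w) (mu0 * w ^ 2)) as hdet.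
  pose proof (monodromy_matrix M (eps1 w) (eps2 w) (mu0 * w ^ 2)) as hT.
  rewrite had in *. clear had.
  set (e1 := eps1 w) in *. set (e2 := eps2 w) in *. set (m := mu0 * w ^ 2) in *.
  set (a := mon_a M e1 e2 m) in *. set (b := mon_b M e1 e2 m) in *.
  set (c := mon_c M e1 e2 m) in *.
  assert (ha' : -1 <= a <= 1) by (apply Rabs_le_between; exact ha).
  set (k := acos a).
  assert (hcos : cos k = a) by (apply cos_acos; exact ha').
  assert (hsc : sin k * sin k = - (b * c)).
  { pose proof (sin2_cos2 k) as h. unfold Rsqr in h. rewrite hcos in h. lra. }
  (* real and imaginary parts of an eigenvector for exp(ik) *)
  assert (hv : exists vr vi : R * R,
    monodromy M e1 e2 m vr = lin (cos k) vr (- sin k) vi /\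
    monodromy M e1 e2 m vi = lin (sin k) vr (cos k) vi /\
    (vr <> (0, 0) \/ vi <> (0, 0))).
  { destruct (Req_dec b 0) as [hb|hb].
    - assert (hs : sin k = 0) by nra.
      exists (0, 1), (0, 0). rewrite !hT, hs, hcos, hb. unfold lin; simpl.
      split; [f_equal; ring|]. split; [f_equal; ring|].
      left. intros h. injection h. lra.
    - exists (b, 0), (0, sin k). rewrite !hT, hcos. unfold lin; simpl.
      split; [f_equal; lra|]. split; [f_equal; lra|].
      left. intros h. injection h. lra. }
  destruct hv as [vr [vi [hr [hi hnz]]]].
  pose (cr := fun n : Z => lin (cos (IZR n * k)) vr (- sin (IZR n * k)) vi).
  pose (ci := fun n : Z => lin (sin (IZR n * k)) vr (cos (IZR n * k)) vi).
  assert (hstep : forall s t y z, monodromy M e1 e2 m (lin s y t z) =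
    lin s (monodromy M e1 e2 m y) t (monodromy M e1 e2 m z))
    by (intros; apply transfer_lin).
  assert (hcr : forall n, cr (n + 1)%Z = monodromy M e1 e2 m (cr n)).
  { intros n. unfold cr. rewrite hstep, hr, hi, plus_IZR.
    replace ((IZR n + 1) * k) with (IZR n * k + k) by ring.
    rewrite cos_plus, sin_plus. unfold lin; simpl. f_equal; ring. }
  assert (hci : forall n, ci (n + 1)%Z = monodromy M e1 e2 m (ci n)).
  { intros n. unfold ci. rewrite hstep, hr, hi, plus_IZR.
    replace ((IZR n + 1) * k) with (IZR n * k + k) by ring.
    rewrite cos_plus, sin_plus. unfold lin; simpl. f_equal; ring. }
  pose proof (line_solution_is_sol M e1 e2 m cr hcr) as hUr.
  pose proof (line_solution_is_sol M e1 e2 m ci hci) as hUi.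
  assert (hper : forall x, fst (line_solution M e1 e2 m cr (x + 1)) =
      cos k * fst (line_solution M e1 e2 m cr x) - sin k * fst (line_solution M e1 e2 m ci x)
    /\ fst (line_solution M e1 e2 m ci (x + 1)) =
      cos k * fst (line_solution M e1 e2 m ci x) + sin k * fst (line_solution M e1 e2 m cr x)).
  { intros x. unfold line_solution. rewrite (Zfloor_addz 1 x), plus_IZR.
    replace (x + 1 - (IZR (Zfloor x) + 1)) with (x - IZR (Zfloor x)) by ring.
    assert (er : cr (Zfloor x + 1)%Z =
      lin (cos k) (cr (Zfloor x)) (- sin k) (ci (Zfloor x))).
    { unfold cr, ci. rewrite plus_IZR.
      replace ((IZR (Zfloor x) + 1) * k) with (IZR (Zfloor x) * k + k) by ring.
      rewrite cos_plus, sin_plus. unfold lin; simpl. f_equal; ring. }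
    assert (ei : ci (Zfloor x + 1)%Z =
      lin (cos k) (ci (Zfloor x)) (sin k) (cr (Zfloor x))).
    { unfold cr, ci. rewrite plus_IZR.
      replace ((IZR (Zfloor x) + 1) * k) with (IZR (Zfloor x) * k + k) by ring.
      rewrite cos_plus, sin_plus. unfold lin; simpl. f_equal; ring. }
    rewrite er, ei. unfold cell_solution. rewrite !cell_state_lin.
    unfold lin; simpl. split; ring. }
  set (Ur := fun x => fst (line_solution M e1 e2 m cr x)) in *.
  set (Ui := fun x => fst (line_solution M e1 e2 m ci x)) in *.
  assert (hq : forall x, (Ur (x + 1), Ui (x + 1)) = Cmult (Cexpi k) (Ur x, Ui x)).
  { intros x. unfold Cmult, Cexpi; simpl. unfold Ur, Ui.
    destruct (hper x) as [e e']. rewrite e, e'. f_equal; ring. }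
  split; [exact h1|]. split; [exact h2|].
  exists k, (fun x => (Ur x, Ui x)). split; [|split; [|split; [|split]]].
  - pose proof (acos_bound a). pose proof PI_RGT_0. unfold k. lra.
  - eapply is_sol_solution_C; eauto.
  - apply Classical_Prop.NNPP. intros hn.
    assert (h0 : forall x, Ur x = 0 /\ Ui x = 0).
    { intros x. apply Classical_Prop.NNPP. intros hx. apply hn. exists x.
      intros h. apply hx. injection h. auto. }
    assert (hdata : forall cc, line_solution M e1 e2 m cc 0 = cc 0%Z).
    { intros cc. unfold line_solution. rewrite (Zfloor_eq 0) by (simpl; lra).
      rewrite Rminus_diag. apply cell_state_0. lia. }
    assert (hz : forall cc, is_sol M e1 e2 m (fun _ => True)
       (fun x => fst (line_solution M e1 e2 m cc x))
       (fun x => snd (line_solution M e1 e2 m cc x)) ->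
       (forall x, fst (line_solution M e1 e2 m cc x) = 0) -> cc 0%Z = (0, 0)).
    { intros cc hs hcc. rewrite (surjective_pairing (cc 0%Z)), <- hdata.
      rewrite hcc, (is_sol_zero _ _ _ _ _ _ h1 hs hcc). reflexivity. }
    pose proof (hz cr hUr (fun x => proj1 (h0 x))) as hzr.
    pose proof (hz ci hUi (fun x => proj2 (h0 x))) as hzi.
    unfold cr, ci in hzr, hzi. rewrite Rmult_0_l, cos_0, sin_0 in hzr, hzi.
    unfold lin in hzr, hzi. injection hzr. injection hzi. intros.
    destruct hnz as [hnz|hnz]; apply hnz; [rewrite (surjective_pairing vr) |
      rewrite (surjective_pairing vi)]; f_equal; lra.
  - exact hq.
  - intros x du hd.
    destruct (is_derive_components _ _ _ hd) as [hdr hdi].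
    apply (is_derive_ext (fun y : R =>
      (cos k * Ur (y - 1) - sin k * Ui (y - 1), cos k * Ui (y - 1) + sin k * Ur (y - 1)))).
    + intros t. replace t with ((t - 1) + 1) at 5 6 by ring. rewrite hq.
      unfold Cmult, Cexpi; simpl. f_equal; ring.
    + assert (hsh : forall (f : R -> R) d, is_derive f x d ->
        is_derive (fun y => f (y - 1)) (x + 1) d).
      { intros f d h. apply is_derive_shift. replace (x + 1 - 1) with x by ring. exact h. }
      pose proof (hsh _ _ hdr) as hdr'. pose proof (hsh _ _ hdi) as hdi'.
      cbn [fst snd] in hdr', hdi'.
      apply is_derive_pair.
      * apply (is_derive_minus (fun y => cos k * Ur (y - 1)) (fun y => sin k * Ui (y - 1)));
          apply is_derive_scal; assumption.
      * evar_last.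
        -- apply (is_derive_plus (fun y => cos k * Ui (y - 1)) (fun y => sin k * Ur (y - 1)));
           apply is_derive_scal; eassumption.
        -- unfold plus; simpl. ring.
Qed.

(** * Floquet solutions in a gap *)

(** For a symmetric cell and [s^2 = b c], the vector [(b, s)] is an eigenvector
    of the monodromy matrix with multiplier [a + s]; this is the solution it
    generates. *)
Definition floquet (M : unit_cell) (e1 e2 m s : R) : R -> R * R :=
  line_solution M e1 e2 m (fun k : Z =>
    (powerRZ (mon_a M e1 e2 m + s) k * mon_b M e1 e2 m,
     powerRZ (mon_a M e1 e2 m + s) k * s)).

(** The monodromy matrix has equal diagonal entries, and [s] is a nonzero square
    root of [b c], that is, of [a^2 - 1]. *)
Definition hyperbolic (M : unit_cell) (e1 e2 m s : R) : Prop :=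
  mon_d M e1 e2 m = mon_a M e1 e2 m /\
  s * s = mon_b M e1 e2 m * mon_c M e1 e2 m /\ s <> 0.

Lemma hyperbolic_opp (M : unit_cell) (e1 e2 m s : R) :
  hyperbolic M e1 e2 m s -> hyperbolic M e1 e2 m (- s).
Proof. intros [h1 [h2 h3]]. split; [auto|]. split; [lra|]. lra. Qed.

Lemma hyperbolic_b (M : unit_cell) (e1 e2 m s : R) :
  hyperbolic M e1 e2 m s -> mon_b M e1 e2 m <> 0.
Proof. intros [h1 [h2 h3]] h. apply h3. rewrite h in h2. nra. Qed.

Lemma hyperbolic_multipliers (M : unit_cell) (e1 e2 m s : R) :
  hyperbolic M e1 e2 m s -> (mon_a M e1 e2 m + s) * (mon_a M e1 e2 m - s) = 1.
Proof.
  intros [h1 [h2 h3]]. pose proof (monodromy_det M e1 e2 m) as h.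
  rewrite h1 in h. lra.
Qed.

Lemma hyperbolic_multiplier_neq (M : unit_cell) (e1 e2 m s : R) :
  hyperbolic M e1 e2 m s -> mon_a M e1 e2 m + s <> 0.
Proof. intros h e. pose proof (hyperbolic_multipliers _ _ _ _ _ h). nra. Qed.

Lemma powerRZ_succ (x : R) (k : Z) : x <> 0 -> powerRZ x (k + 1) = x * powerRZ x k.
Proof. intros h. rewrite powerRZ_add by exact h. simpl. ring. Qed.

Lemma floquet_orbit (M : unit_cell) (e1 e2 m s : R) (k : Z) :
  hyperbolic M e1 e2 m s ->
  (powerRZ (mon_a M e1 e2 m + s) (k + 1) * mon_b M e1 e2 m,
   powerRZ (mon_a M e1 e2 m + s) (k + 1) * s) =
  monodromy M e1 e2 m (powerRZ (mon_a M e1 e2 m + s) k * mon_b M e1 e2 m,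
                       powerRZ (mon_a M e1 e2 m + s) k * s).
Proof.
  intros h. pose proof (hyperbolic_multiplier_neq _ _ _ _ _ h).
  destruct h as [h1 [h2 h3]].
  rewrite monodromy_matrix, powerRZ_succ, h1 by assumption.
  f_equal; [ring|].
  transitivity (powerRZ (mon_a M e1 e2 m + s) k * (mon_a M e1 e2 m * s + s * s));
    [ring|]. rewrite h2. ring.
Qed.

Lemma floquet_is_sol (M : unit_cell) (e1 e2 m s : R) (I : R -> Prop) :
  hyperbolic M e1 e2 m s ->
  is_sol M e1 e2 m I (fun x => fst (floquet M e1 e2 m s x))
    (fun x => snd (floquet M e1 e2 m s x)).
Proof.
  intros h.
  destruct (line_solution_is_sol M e1 e2 m _ (fun k => floquet_orbit M e1 e2 m s k h))
    as [h1 [h2 h3]].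
  split; [|split]; intros x _; [apply h1 | apply h2 | apply h3]; exact Logic.I.
Qed.

Lemma floquet_int (M : unit_cell) (e1 e2 m s : R) (k : Z) :
  floquet M e1 e2 m s (IZR k) =
  (powerRZ (mon_a M e1 e2 m + s) k * mon_b M e1 e2 m,
   powerRZ (mon_a M e1 e2 m + s) k * s).
Proof.
  unfold floquet, line_solution. rewrite ZfloorZ, Rminus_diag.
  apply cell_state_0. lia.
Qed.

Lemma floquet_bound (M : unit_cell) (e1 e2 m s : R) :
  exists K, 0 < K /\ forall x, Rabs (fst (floquet M e1 e2 m s x)) <=
    Rabs (powerRZ (mon_a M e1 e2 m + s) (Zfloor x)) * K.
Proof.
  set (y := (mon_b M e1 e2 m, s)).
  destruct (continuity_ab_maj (fun x => Rabs (fst (cell_solution M e1 e2 m y x))) 0 1)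
    as [x0 [hx0 _]]; [lra| |].
  { intros x _. apply (continuity_pt_comp _ Rabs); [|apply Rcontinuity_abs].
    apply continuity_pt_filterlim, cell_state_continuous. lia. }
  set (K := Rabs (fst (cell_solution M e1 e2 m y x0))) in *.
  exists (K + 1). assert (0 <= K) by apply Rabs_pos. split; [lra|].
  intros x. unfold floquet, line_solution.
  set (p := powerRZ (mon_a M e1 e2 m + s) (Zfloor x)).
  replace (p * mon_b M e1 e2 m, p * s) with (lin p y 0 y)
    by (unfold lin, y; simpl; f_equal; ring).
  unfold cell_solution. rewrite cell_state_lin. unfold lin; cbn [fst snd].
  rewrite Rmult_0_l, Rplus_0_r, Rabs_mult.
  apply Rmult_le_compat_l; [apply Rabs_pos|].
  pose proof (Zfloor_bound x).
  specialize (hx0 (x - IZR (Zfloor x)) ltac:(lra)). cbv beta in hx0.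
  unfold cell_solution in hx0. lra.
Qed.

Lemma powerRZ_small (x : R) (d : R) : Rabs x < 1 -> 0 < d ->
  exists n0 : Z, (0 <= n0)%Z /\ forall k, (n0 <= k)%Z -> Rabs (powerRZ x k) < d.
Proof.
  intros hx hd.
  pose proof (proj2 (is_lim_seq_spec (fun n => x ^ n) 0) (is_lim_seq_geom x hx)) as hl.
  destruct (hl (mkposreal d hd)) as [N hN].
  exists (Z.of_nat N). split; [lia|]. intros k hk.
  specialize (hN (Z.to_nat k) ltac:(lia)). simpl in hN. rewrite Rminus_0_r in hN.
  rewrite <- (Z2Nat.id k) by lia. rewrite <- pow_powerRZ. exact hN.
Qed.

Lemma powerRZ_opp_inv (x y : R) (k : Z) : x * y = 1 -> powerRZ x (- k) = powerRZ y k.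
Proof.
  intros h. assert (x <> 0) by nra.
  rewrite powerRZ_neg', <- powerRZ_inv'.
  replace (/ x) with y; [reflexivity|].
  apply (Rmult_eq_reg_l x); [|assumption]. rewrite Rinv_r by assumption. exact h.
Qed.

Lemma floquet_decay_right (M : unit_cell) (e1 e2 m s : R) :
  Rabs (mon_a M e1 e2 m + s) < 1 ->
  is_lim (fun x => fst (floquet M e1 e2 m s x)) p_infty 0.
Proof.
  intros hs. apply is_lim_spec. intros [d hd].
  destruct (floquet_bound M e1 e2 m s) as [K [hK hb]].
  destruct (powerRZ_small _ (d / K) hs ltac:(apply Rdiv_lt_0_compat; lra))
    as [n0 [_ hn]].
  exists (IZR n0). intros x hx. simpl. rewrite Rminus_0_r.
  eapply Rle_lt_trans; [apply hb|].
  pose proof (Zfloor_bound x).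
  apply Rmult_lt_reg_r with (/ K); [apply Rinv_0_lt_compat, hK|].
  rewrite Rmult_assoc, Rinv_r, Rmult_1_r by lra.
  apply hn. apply Zfloor_lub. lra.
Qed.

Lemma floquet_decay_left (M : unit_cell) (e1 e2 m s : R) :
  hyperbolic M e1 e2 m s -> Rabs (mon_a M e1 e2 m - s) < 1 ->
  is_lim (fun x => fst (floquet M e1 e2 m s x)) m_infty 0.
Proof.
  intros h hs. apply is_lim_spec. intros [d hd].
  destruct (floquet_bound M e1 e2 m s) as [K [hK hb]].
  destruct (powerRZ_small _ (d / K) hs ltac:(apply Rdiv_lt_0_compat; lra))
    as [n0 [_ hn]].
  exists (- IZR n0). intros x hx. simpl. rewrite Rminus_0_r.
  eapply Rle_lt_trans; [apply hb|].
  pose proof (Zfloor_bound x).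
  apply Rmult_lt_reg_r with (/ K); [apply Rinv_0_lt_compat, hK|].
  rewrite Rmult_assoc, Rinv_r, Rmult_1_r by lra.
  rewrite <- (Z.opp_involutive (Zfloor x)).
  rewrite (powerRZ_opp_inv _ _ _ (hyperbolic_multipliers _ _ _ _ _ h)).
  apply hn. apply le_IZR. rewrite opp_IZR. lra.
Qed.

(** A solution that is small at far away integers where the Floquet solution
    for [s] decays and the one for [- s] does not is a multiple of the former. *)
Lemma decaying_multiple (M : unit_cell) (e1 e2 m s : R) (I : R -> Prop)
  (u q : R -> R) :
  hyperbolic M e1 e2 m s -> is_sol M e1 e2 m I u q ->
  (forall x y z, I x -> I y -> x <= z <= y -> I z) ->
  (forall d, 0 < d -> exists k : Z, I (IZR k) /\ Rabs (u (IZR k)) < d /\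
    Rabs (powerRZ (mon_a M e1 e2 m + s) k) < d /\
    1 <= Rabs (powerRZ (mon_a M e1 e2 m - s) k)) ->
  exists al, forall x, I x -> u x = al * fst (floquet M e1 e2 m s x) /\
    q x = al * snd (floquet M e1 e2 m s x).
Proof.
  intros h hu hI hfar.
  pose proof (hyperbolic_b _ _ _ _ _ h) as hb.
  set (b := mon_b M e1 e2 m) in *. set (a := mon_a M e1 e2 m) in *.
  (* [f] decays along the integers of [hfar], and [g] does not *)
  set (f := floquet M e1 e2 m s). set (g := floquet M e1 e2 m (- s)).
  pose proof (floquet_is_sol M e1 e2 m s I h) as hf.
  pose proof (floquet_is_sol M e1 e2 m (- s) I (hyperbolic_opp _ _ _ _ _ h)) as hg.
  fold f in hf. fold g in hg.
  assert (hconst : forall v p v' p', is_sol M e1 e2 m I v p ->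
    is_sol M e1 e2 m I v' p' -> forall x y, I x -> I y ->
    wronskian (v x, p x) (v' x, p' x) = wronskian (v y, p y) (v' y, p' y)).
  { intros v p v' p' hv hv' x y hx hy.
    destruct (Rle_dec x y); [|symmetry];
    eapply is_sol_wronskian; eauto; lra. }
  destruct (hfar 1 ltac:(lra)) as [k0 [hk0 _]].
  set (x0 := IZR k0) in *.
  set (W0 := wronskian (f x0) (g x0)).
  set (K1 := wronskian (u x0, q x0) (f x0)).
  set (K2 := wronskian (u x0, q x0) (g x0)).
  assert (hW : forall x, I x -> wronskian (f x) (g x) = W0 /\
     wronskian (u x, q x) (f x) = K1 /\ wronskian (u x, q x) (g x) = K2).
  { intros x hx. pose proof (hconst _ _ _ _ hf hg x x0 hx hk0) as h1.
    pose proof (hconst _ _ _ _ hu hf x x0 hx hk0) as h2.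
    pose proof (hconst _ _ _ _ hu hg x x0 hx hk0) as h3.
    unfold W0, K1, K2, wronskian in *. cbn [fst snd] in *. auto. }
  (* expansion of the solution along the two Floquet solutions *)
  assert (hexp : forall x, I x ->
    u x * W0 = K2 * fst (f x) - K1 * fst (g x) /\
    q x * W0 = K2 * snd (f x) - K1 * snd (g x)).
  { intros x hx. destruct (hW x hx) as [h1 [h2 h3]].
    rewrite <- h1, <- h2, <- h3. unfold wronskian; cbn [fst snd]. split; ring. }
  assert (hs : s <> 0) by apply h.
  assert (hW0 : W0 <> 0).
  { unfold W0, f, g, x0. rewrite !floquet_int. fold a b.
    unfold wronskian; cbn [fst snd]. fold (a - s).
    intros e.
    pose proof (powerRZ_NOR (a + s) k0 (hyperbolic_multiplier_neq _ _ _ _ _ h)).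
    pose proof (powerRZ_NOR (a - s) k0
       (hyperbolic_multiplier_neq _ _ _ _ _ (hyperbolic_opp _ _ _ _ _ h))).
    assert (e' : 2 * (powerRZ (a + s) k0 * (powerRZ (a - s) k0 * (b * s))) = 0) by lra.
    apply Rmult_integral in e'. destruct e' as [e'|e']; [lra|].
    apply Rmult_integral in e'. destruct e' as [e'|e']; [tauto|].
    apply Rmult_integral in e'. destruct e' as [e'|e']; [tauto|].
    apply Rmult_integral in e'. tauto. }
  (* otherwise the part along [g] would not be small at far away integers *)
  assert (hK1 : K1 = 0).
  { apply Classical_Prop.NNPP. intros hne.
    pose proof (Rabs_pos_lt _ hne) as p1.
    pose proof (Rabs_pos_lt _ hb) as p2.
    pose proof (Rabs_pos_lt _ hW0) as p3.
    pose proof (Rabs_pos K2) as p4.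
    set (C := Rabs W0 + Rabs K2 * Rabs b).
    assert (hC : 0 < C) by (unfold C; nra).
    destruct (hfar (Rabs K1 * Rabs b / C)) as [k [hk [h1 [h2 h3]]]].
    { apply Rdiv_lt_0_compat; nra. }
    destruct (hexp _ hk) as [e _].
    unfold f, g in e. rewrite !floquet_int in e. fold a b in e. cbn [fst] in e.
    fold (a - s) in e.
    set (d := Rabs K1 * Rabs b / C) in *.
    assert (hdC : d * C = Rabs K1 * Rabs b) by (unfold d; field; lra).
    assert (e1' : K1 * (powerRZ (a - s) k * b) =
       K2 * (powerRZ (a + s) k * b) - u (IZR k) * W0) by lra.
    apply (f_equal Rabs) in e1'. rewrite !Rabs_mult in e1'.
    pose proof (Rabs_triang (K2 * (powerRZ (a + s) k * b)) (- (u (IZR k) * W0))) as ht.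
    rewrite Rabs_Ropp, !Rabs_mult in ht.
    fold (K2 * (powerRZ (a + s) k * b) - u (IZR k) * W0) in ht.
    rewrite <- e1' in ht.
    assert (t1 : Rabs K1 * Rabs b <= Rabs K1 * (Rabs (powerRZ (a - s) k) * Rabs b)).
    { apply Rmult_le_compat_l; [lra|]. nra. }
    assert (t2 : Rabs K2 * (Rabs (powerRZ (a + s) k) * Rabs b) <= Rabs K2 * (d * Rabs b)).
    { apply Rmult_le_compat_l; [lra|]. apply Rmult_le_compat_r; lra. }
    assert (t3 : Rabs (u (IZR k)) * Rabs W0 < d * Rabs W0).
    { apply Rmult_lt_compat_r; lra. }
    unfold C in hdC. lra. }
  exists (K2 / W0). intros x hx. destruct (hexp x hx) as [e e'].
  rewrite hK1 in e, e'. split.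
  - apply (Rmult_eq_reg_r W0); [|exact hW0]. rewrite e. field. exact hW0.
  - apply (Rmult_eq_reg_r W0); [|exact hW0]. rewrite e'. field. exact hW0.
Qed.

(** * Surface impedances *)

Lemma floquet_0 (M : unit_cell) (e1 e2 m s : R) :
  floquet M e1 e2 m s 0 = (mon_b M e1 e2 m, s).
Proof. rewrite (floquet_int M e1 e2 m s 0). simpl. f_equal; ring. Qed.

Lemma floquet_lim_value (M : unit_cell) (e1 e2 m s : R) :
  hyperbolic M e1 e2 m s ->
  filterlim (fun x => fst (floquet M e1 e2 m s x)) (locally 0)
    (locally (mon_b M e1 e2 m)).
Proof.
  intros h. destruct (floquet_is_sol M e1 e2 m s (fun _ => True) h) as [hc _].
  specialize (hc 0 Logic.I). unfold continuous in hc. rewrite floquet_0 in hc. exact hc.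
Qed.

Lemma floquet_lim_flux (M : unit_cell) (e1 e2 m s : R) :
  hyperbolic M e1 e2 m s ->
  filterlim (fun x => snd (floquet M e1 e2 m s x)) (locally 0) (locally s).
Proof.
  intros h. destruct (floquet_is_sol M e1 e2 m s (fun _ => True) h) as [_ [_ hq]].
  pose proof (continuous_of_derive _ _ _ (hq 0 Logic.I)) as hc.
  unfold continuous in hc. rewrite floquet_0 in hc. exact hc.
Qed.

(** Particles of the first kind lie on both sides of 0, because the cell begins
    and ends with one. *)
Lemma medium_near_0 (M : unit_cell) (e1 e2 : R) :
  exists d, 0 < d /\ forall x, x <> 0 -> Rabs x < d ->
    ~ interface M x /\ medium M e1 e2 x = e1.
Proof.
  set (n := (2 * cell_N M)%nat).
  pose proof (node_lt M 0 1 ltac:(lia) ltac:(lia)) as h1. rewrite node_first in h1.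
  pose proof (node_lt M n (S n) ltac:(lia) ltac:(lia)) as h2.
  pose proof (node_last M) as hl. replace (2 * cell_N M + 1)%nat with (S n) in hl by lia.
  rewrite hl in h2.
  pose proof (node_range M 1 ltac:(lia)). pose proof (node_range M n ltac:(lia)).
  exists (Rmin (node M 1) (1 - node M n)). split.
  { apply Rmin_glb_lt; lra. }
  intros x hx hd.
  assert (hd1 : Rabs x < node M 1) by (eapply Rlt_le_trans; [exact hd | apply Rmin_l]).
  assert (hd2 : Rabs x < 1 - node M n) by (eapply Rlt_le_trans; [exact hd | apply Rmin_r]).
  apply Rabs_def2 in hd1, hd2.
  destruct (Rtotal_order x 0) as [hneg|[h0|hpos]]; [|tauto|].
  - split.
    + intros [k [i [hi e]]]. pose proof (node_range M i hi).
      assert (hk : (k = -1 \/ k = -2)%Z).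
      { assert (k < 0)%Z by (apply lt_IZR; simpl; lra).
        assert (-3 < k)%Z by (apply lt_IZR; simpl; lra). lia. }
      destruct hk as [-> | ->]; simpl in e; [|lra].
      destruct (Nat.eq_dec i (S n)) as [->|]; [lra|].
      pose proof (node_le M i n ltac:(lia) ltac:(lia)). lra.
    + rewrite (medium_particle M e1 e2 x (-1) n); [| lia | simpl; lra].
      unfold particle_eps, n. rewrite Nat.even_mul. reflexivity.
  - split.
    + intros [k [i [hi e]]]. pose proof (node_range M i hi).
      assert (hk : (k = 0 \/ k = -1)%Z).
      { assert (k < 1)%Z by (apply lt_IZR; simpl; lra).
        assert (-2 < k)%Z by (apply lt_IZR; simpl; lra). lia. }
      destruct hk as [-> | ->]; simpl in e; [|lra].
      destruct i as [|i]; [rewrite node_first in e; lra|].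
      pose proof (node_le M 1 (S i) ltac:(lia) hi). lra.
    + rewrite (medium_particle M e1 e2 x 0 0); [reflexivity | lia |].
      rewrite node_first. simpl. lra.
Qed.

(** Near 0 the derivative is the flux times the permittivity of the first kind;
    [F] stands for a one-sided filter at 0. *)
Lemma derive_lim (M : unit_cell) (e1 e2 m q0 : R) (I : R -> Prop)
  (F : (R -> Prop) -> Prop) (FF : ProperFilter F) (u q : R -> R) :
  is_sol M e1 e2 m I u q ->
  filter_le F (locally 0) -> F I -> F (fun x => x <> 0) ->
  filterlim q F (locally q0) -> filterlim (Derive u) F (locally (e1 * q0)).
Proof.
  intros [_ [hu _]] hF hI hne hq.
  destruct (medium_near_0 M e1 e2) as [d [hd hmed]].
  apply (filterlim_ext_loc (fun x => e1 * q x)).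
  - apply (filter_imp (fun x => (I x /\ x <> 0) /\ Rabs x < d)).
    + intros x [[hx hx0] hxd]. destruct (hmed x hx0 hxd) as [hn he].
      symmetry. apply is_derive_unique.
      evar_last; [apply hu; assumption|]. rewrite he. reflexivity.
    + apply filter_and; [apply filter_and; assumption|].
      apply hF. exists (mkposreal d hd). intros y hy.
      rewrite <- (Rminus_0_r y). exact hy.
  - eapply filterlim_comp; [exact hq | apply (filterlim_scal_r e1 q0)].
Qed.

(** One-sided data at 0 of a multiple of a Floquet solution. *)
Lemma multiple_data (M : unit_cell) (e1 e2 m s al : R) (I : R -> Prop)
  (F : (R -> Prop) -> Prop) (FF : ProperFilter F) (u q : R -> R) (u0 du0 : R) :
  hyperbolic M e1 e2 m s -> is_sol M e1 e2 m I u q ->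
  filter_le F (locally 0) -> F I -> F (fun x => x <> 0) ->
  (forall x, I x -> u x = al * fst (floquet M e1 e2 m s x) /\
    q x = al * snd (floquet M e1 e2 m s x)) ->
  filterlim u F (locally u0) -> filterlim (Derive u) F (locally du0) ->
  u0 = al * mon_b M e1 e2 m /\ du0 = e1 * (al * s).
Proof.
  intros h hu hF hI hne hal hlu hldu.
  split.
  - apply (filterlim_locally_unique u u0 (al * mon_b M e1 e2 m) hlu).
    apply (filterlim_ext_loc (fun x => al * fst (floquet M e1 e2 m s x))).
    + apply (filter_imp I); [|exact hI]. intros x hx. symmetry. apply hal, hx.
    + eapply filterlim_filter_le_1; [exact hF|].
      eapply filterlim_comp; [apply floquet_lim_value, h|].
      apply (filterlim_scal_r al (mon_b M e1 e2 m)).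
  - apply (filterlim_locally_unique (Derive u) du0 (e1 * (al * s)) hldu).
    apply (derive_lim M e1 e2 m (al * s) I F FF u q hu hF hI hne).
    apply (filterlim_ext_loc (fun x => al * snd (floquet M e1 e2 m s x))).
    + apply (filter_imp I); [|exact hI]. intros x hx. symmetry. apply hal, hx.
    + eapply filterlim_filter_le_1; [exact hF|].
      eapply filterlim_comp; [apply floquet_lim_flux, h|].
      apply (filterlim_scal_r al s).
Qed.

Lemma floquet_nonzero (M : unit_cell) (e1 e2 m s : R) (k : Z) :
  hyperbolic M e1 e2 m s -> fst (floquet M e1 e2 m s (IZR k)) <> 0.
Proof.
  intros h. rewrite floquet_int. apply Rmult_integral_contrapositive_currified.
  - apply powerRZ_NOR, (hyperbolic_multiplier_neq _ _ _ _ _ h).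
  - apply (hyperbolic_b _ _ _ _ _ h).
Qed.

Lemma multiplier_opp_large (x y : R) (k : Z) :
  x * y = 1 -> Rabs x < 1 -> (0 <= k)%Z -> 1 <= Rabs (powerRZ y k).
Proof.
  intros h hx hk. rewrite <- (Z2Nat.id k) by lia. rewrite <- pow_powerRZ, <- RPow_abs.
  apply pow_R1_Rle. apply (f_equal Rabs) in h. rewrite Rabs_mult, Rabs_R1 in h.
  pose proof (Rabs_pos x). pose proof (Rabs_pos y). nra.
Qed.

(** The solution generated by [(b, s)] is the one that decays to the right. *)
Lemma impedance_plus_eq (mu0 : R) (eps1 eps2 : R -> R) (M : unit_cell) (w s : R) :
  0 < mu0 -> eps1 w <> 0 -> eps2 w <> 0 ->
  hyperbolic M (eps1 w) (eps2 w) (mu0 * w ^ 2) s ->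
  Rabs (mon_a M (eps1 w) (eps2 w) (mu0 * w ^ 2) + s) < 1 ->
  impedance_plus mu0 eps1 eps2 M w = mon_b M (eps1 w) (eps2 w) (mu0 * w ^ 2) / s.
Proof.
  intros hmu h1 h2 h hs.
  set (m := mu0 * w ^ 2) in *.
  assert (hs0 : s <> 0) by apply h.
  assert (hF : filter_le (at_right 0) (locally 0)) by apply filter_le_within.
  assert (hI : at_right 0 (fun x => 0 < x)).
  { exists (mkposreal 1 Rlt_0_1). intros y _ hy. exact hy. }
  assert (hne : at_right 0 (fun x => x <> 0)).
  { exists (mkposreal 1 Rlt_0_1). intros y _ hy. lra. }
  assert (hex : is_impedance_plus mu0 eps1 eps2 M w (mon_b M (eps1 w) (eps2 w) m / s)).
  { exists (fun x => fst (floquet M (eps1 w) (eps2 w) m s x)),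
      (mon_b M (eps1 w) (eps2 w) m), (eps1 w * s).
    split; [|split; [|split; [|split; [|split]]]].
    - eapply is_sol_solution; eauto. apply floquet_is_sol, h.
    - exists 1. split; [lra | apply (floquet_nonzero _ _ _ _ _ 1 h)].
    - apply floquet_decay_right, hs.
    - eapply filterlim_filter_le_1; [exact hF | apply floquet_lim_value, h].
    - eapply derive_lim; [| apply (floquet_is_sol _ _ _ _ _ (fun x => 0 < x) h) | ..]; eauto.
      + apply at_right_proper_filter.
      + eapply filterlim_filter_le_1; [exact hF | apply floquet_lim_flux, h].
    - field. auto. }
  assert (huniq : forall z, is_impedance_plus mu0 eps1 eps2 M w z ->
    z = mon_b M (eps1 w) (eps2 w) m / s).
  { intros z [u [u0 [du0 [hsol [[x1 [hx1 hux1]] [hlim [hu0 [hdu0 ->]]]]]]]].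
    destruct (solution_is_sol _ _ _ _ _ _ _ hmu h1 h2 hsol) as [q hq]. fold m in hq.
    destruct (decaying_multiple M (eps1 w) (eps2 w) m s (fun x => 0 < x) u q h hq)
      as [al hal].
    - intros; lra.
    - intros d hd. destruct (powerRZ_small _ d hs hd) as [n0 [hn0 hn]].
      destruct (proj2 (is_lim_spec _ _ _) hlim (mkposreal d hd)) as [B hB]. simpl in hB.
      exists (Z.max (n0 + 1) (Zfloor B + 1)).
      set (k := Z.max (n0 + 1) (Zfloor B + 1)).
      assert (hk : 0 < IZR k) by (apply (IZR_lt 0); lia).
      split; [exact hk|]. split; [|split].
      + rewrite <- (Rminus_0_r (u (IZR k))). apply hB.
        pose proof (Zfloor_bound B).
        assert (IZR (Zfloor B + 1) <= IZR k) by (apply IZR_le; lia).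
        rewrite plus_IZR in *. lra.
      + apply hn. lia.
      + apply (multiplier_opp_large _ _ k (hyperbolic_multipliers _ _ _ _ _ h) hs). lia.
    - assert (hal0 : al <> 0).
      { intros e. apply hux1. rewrite (proj1 (hal x1 hx1)), e. ring. }
      destruct (multiple_data M (eps1 w) (eps2 w) m s al (fun x => 0 < x) (at_right 0)
        (at_right_proper_filter 0) u q u0 du0) as [-> ->]; auto.
      field. auto. }
  apply huniq. unfold impedance_plus. apply epsilon_spec. eexists; exact hex.
Qed.

(** The solution generated by [(b, s)] is the one that decays to the left, since
    the inverse of its multiplier is [a - s]. *)
Lemma impedance_minus_eq (mu0 : R) (eps1 eps2 : R -> R) (M : unit_cell) (w s : R) :
  0 < mu0 -> eps1 w <> 0 -> eps2 w <> 0 ->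
  hyperbolic M (eps1 w) (eps2 w) (mu0 * w ^ 2) s ->
  Rabs (mon_a M (eps1 w) (eps2 w) (mu0 * w ^ 2) - s) < 1 ->
  impedance_minus mu0 eps1 eps2 M w = - (mon_b M (eps1 w) (eps2 w) (mu0 * w ^ 2) / s).
Proof.
  intros hmu h1 h2 h hs.
  set (m := mu0 * w ^ 2) in *.
  assert (hs0 : s <> 0) by apply h.
  assert (hF : filter_le (at_left 0) (locally 0)) by apply filter_le_within.
  assert (hI : at_left 0 (fun x => x < 0)).
  { exists (mkposreal 1 Rlt_0_1). intros y _ hy. exact hy. }
  assert (hne : at_left 0 (fun x => x <> 0)).
  { exists (mkposreal 1 Rlt_0_1). intros y _ hy. lra. }
  assert (hex : is_impedance_minus mu0 eps1 eps2 M w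
    (- (mon_b M (eps1 w) (eps2 w) m / s))).
  { exists (fun x => fst (floquet M (eps1 w) (eps2 w) m s x)),
      (mon_b M (eps1 w) (eps2 w) m), (eps1 w * s).
    split; [|split; [|split; [|split; [|split]]]].
    - eapply is_sol_solution; eauto. apply floquet_is_sol, h.
    - exists (-1). split; [lra | apply (floquet_nonzero _ _ _ _ _ (-1) h)].
    - apply floquet_decay_left; assumption.
    - eapply filterlim_filter_le_1; [exact hF | apply floquet_lim_value, h].
    - eapply derive_lim; [| apply (floquet_is_sol _ _ _ _ _ (fun x => x < 0) h) | ..]; eauto.
      + apply at_left_proper_filter.
      + eapply filterlim_filter_le_1; [exact hF | apply floquet_lim_flux, h].
    - field. auto. }
  assert (huniq : forall z, is_impedance_minus mu0 eps1 eps2 M w z ->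
    z = - (mon_b M (eps1 w) (eps2 w) m / s)).
  { intros z [u [u0 [du0 [hsol [[x1 [hx1 hux1]] [hlim [hu0 [hdu0 ->]]]]]]]].
    destruct (solution_is_sol _ _ _ _ _ _ _ hmu h1 h2 hsol) as [q hq]. fold m in hq.
    destruct (decaying_multiple M (eps1 w) (eps2 w) m s (fun x => x < 0) u q h hq)
      as [al hal].
    - intros; lra.
    - intros d hd. destruct (powerRZ_small _ d hs hd) as [n0 [hn0 hn]].
      destruct (proj2 (is_lim_spec _ _ _) hlim (mkposreal d hd)) as [B hB]. simpl in hB.
      exists (- Z.max (n0 + 1) (Zfloor (- B) + 1))%Z.
      set (k := Z.max (n0 + 1) (Zfloor (- B) + 1)).
      assert (hk : 0 < IZR k) by (apply (IZR_lt 0); lia).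
      pose proof (hyperbolic_multipliers _ _ _ _ _ h) as hprod.
      split; [rewrite opp_IZR; lra|]. split; [|split].
      + rewrite <- (Rminus_0_r (u (IZR (- k)))). apply hB.
        pose proof (Zfloor_bound (- B)).
        assert (IZR (Zfloor (- B) + 1) <= IZR k) by (apply IZR_le; lia).
        rewrite opp_IZR. rewrite plus_IZR in *. lra.
      + rewrite (powerRZ_opp_inv _ _ _ hprod). apply hn. lia.
      + rewrite Rmult_comm in hprod.
        rewrite (powerRZ_opp_inv _ _ _ hprod).
        apply (multiplier_opp_large _ _ k hprod hs). lia.
    - assert (hal0 : al <> 0).
      { intros e. apply hux1. rewrite (proj1 (hal x1 hx1)), e. ring. }
      destruct (multiple_data M (eps1 w) (eps2 w) m s al (fun x => x < 0) (at_left 0)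
        (at_left_proper_filter 0) u q u0 du0) as [-> ->]; auto.
      field. auto. }
  apply huniq. unfold impedance_minus. apply epsilon_spec. eexists; exact hex.
Qed.

(** * The impedance in terms of the monodromy matrix *)

(** For [|a| > 1], the square root of [a^2 - 1] with the sign of [a]. *)
Definition signed_root (a : R) : R := a * sqrt (1 - / (a * a)).

Lemma one_lt_sqr (a : R) : 1 < Rabs a -> 1 < a * a.
Proof. intros h. pose proof (Rabs_pos a). pose proof (Rsqr_abs a) as e. unfold Rsqr in e. nra. Qed.

Lemma signed_root_arg (a : R) : 1 < Rabs a -> 0 < 1 - / (a * a).
Proof.
  intros h. pose proof (one_lt_sqr a h).
  assert (/ (a * a) < 1) by (rewrite <- Rinv_1; apply Rinv_lt_contravar; lra). lra.
Qed.

Lemma signed_root_sqr (a : R) :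
  1 < Rabs a -> signed_root a * signed_root a = a * a - 1.
Proof.
  intros h. pose proof (one_lt_sqr a h). pose proof (signed_root_arg a h).
  unfold signed_root.
  transitivity (a * a * (sqrt (1 - / (a * a)) * sqrt (1 - / (a * a)))); [ring|].
  rewrite sqrt_sqrt by lra. field. nra.
Qed.

Lemma signed_root_sign (a : R) : 1 < Rabs a -> 0 < a * signed_root a.
Proof.
  intros h. pose proof (one_lt_sqr a h). pose proof (signed_root_arg a h) as h1.
  apply sqrt_lt_R0 in h1. unfold signed_root. rewrite <- Rmult_assoc. nra.
Qed.

Lemma signed_root_contract (a : R) : 1 < Rabs a -> Rabs (a - signed_root a) < 1.
Proof.
  intros h. pose proof (signed_root_sqr a h). pose proof (signed_root_sign a h).
  pose proof (one_lt_sqr a h).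
  set (r := signed_root a) in *.
  assert (h1 : (a - r) * (a + r) = 1) by lra.
  assert (h2 : (a - r) * (a - r) < 1).
  { assert (1 < (a + r) * (a + r)) by nra.
    assert (e : ((a - r) * (a - r)) * ((a + r) * (a + r)) = 1).
    { transitivity (((a - r) * (a + r)) * ((a - r) * (a + r))); [ring|]. rewrite h1. ring. }
    nra. }
  apply Rabs_def1; nra.
Qed.

Lemma signed_root_hyperbolic (M : unit_cell) (e1 e2 m : R) :
  mon_d M e1 e2 m = mon_a M e1 e2 m -> 1 < Rabs (mon_a M e1 e2 m) ->
  hyperbolic M e1 e2 m (signed_root (mon_a M e1 e2 m)).
Proof.
  intros hd ha. pose proof (monodromy_det M e1 e2 m) as hdet. rewrite hd in hdet.
  pose proof (signed_root_sqr _ ha). pose proof (signed_root_sign _ ha).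
  split; [exact hd|]. split; [lra|]. intros e. rewrite e in *. lra.
Qed.

(** Common value of the two impedances. *)
Definition gap_impedance (M : unit_cell) (e1 e2 m : R) : R :=
  - (mon_b M e1 e2 m / signed_root (mon_a M e1 e2 m)).

Lemma impedances_in_gap (mu0 : R) (eps1 eps2 : R -> R) (M : unit_cell)
  (gap : R -> Prop) (w : R) :
  0 < mu0 -> mirror_symmetric eps1 eps2 M -> band_gap mu0 eps1 eps2 M gap ->
  gap w -> eps1 w <> 0 -> eps2 w <> 0 ->
  1 < Rabs (mon_a M (eps1 w) (eps2 w) (mu0 * w ^ 2)) /\
  impedance_plus mu0 eps1 eps2 M w = gap_impedance M (eps1 w) (eps2 w) (mu0 * w ^ 2) /\
  impedance_minus mu0 eps1 eps2 M w = gap_impedance M (eps1 w) (eps2 w) (mu0 * w ^ 2).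
Proof.
  intros hmu hsym [a0 [b0 [_ [_ [hnb _]]]]] hw h1 h2.
  assert (ha : 1 < Rabs (mon_a M (eps1 w) (eps2 w) (mu0 * w ^ 2))).
  { apply Rnot_le_lt. intros hle. apply (hnb w hw).
    apply band_of_half_trace; assumption. }
  pose proof (mirror_mon_d M _ _ (mu0 * w ^ 2) (eps_medium_mirror _ _ M w hsym)) as hd.
  pose proof (signed_root_hyperbolic M _ _ _ hd ha) as hh.
  pose proof (signed_root_contract _ ha) as hc.
  split; [exact ha|]. unfold gap_impedance. split.
  - rewrite (impedance_plus_eq mu0 eps1 eps2 M w _ hmu h1 h2
      (hyperbolic_opp _ _ _ _ _ hh) hc).
    field. apply hh.
  - apply (impedance_minus_eq mu0 eps1 eps2 M w _ hmu h1 h2 hh hc).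
Qed.

(** * Differentiability in the frequency *)

Lemma flow_ex_derive (e m : R -> R) (y : R -> R * R) (x w : R) :
  ex_derive e w -> ex_derive m w ->
  ex_derive (fun w => fst (y w)) w -> ex_derive (fun w => snd (y w)) w ->
  ex_derive (fun w => fst (flow (e w) (m w) x (y w))) w /\
  ex_derive (fun w => snd (flow (e w) (m w) x (y w))) w.
Proof.
  intros he hm h1 h2.
  assert (hC : ex_derive (fun w => cos_prop (e w * m w) x) w).
  { apply (ex_derive_comp Ck (fun w => - (e w * m w * x ^ 2))).
    - eexists; apply Ck_derive.
    - auto_derive; auto. }
  assert (hS : ex_derive (fun w => sin_prop (e w * m w) x) w).
  { apply (ex_derive_scal (fun w => Sk (- (e w * m w * x ^ 2)))).
    apply (ex_derive_comp Sk (fun w => - (e w * m w * x ^ 2))).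
    - eexists; apply Sk_derive.
    - auto_derive; auto. }
  unfold flow; cbn [fst snd]. split.
  - apply (ex_derive_plus (fun w => cos_prop (e w * m w) x * fst (y w))).
    + apply (ex_derive_mult (fun w => cos_prop (e w * m w) x)); auto.
    + apply (ex_derive_mult (fun w => e w * sin_prop (e w * m w) x)); auto.
      apply (ex_derive_mult e); auto.
  - apply (ex_derive_plus (fun w => - m w * sin_prop (e w * m w) x * fst (y w))).
    + apply (ex_derive_mult (fun w => - m w * sin_prop (e w * m w) x)); auto.
      apply (ex_derive_mult (fun w => - m w)); auto. apply (ex_derive_opp m), hm.
    + apply (ex_derive_mult (fun w => cos_prop (e w * m w) x)); auto.
Qed.

Lemma particle_eps_ind (P : (R -> R) -> Prop) (e1 e2 : R -> R) (j : nat) :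
  P e1 -> P e2 -> P (fun w => particle_eps (e1 w) (e2 w) j).
Proof. intros h1 h2. unfold particle_eps. destruct (Nat.even j); assumption. Qed.

Lemma transfer_ex_derive (M : unit_cell) (e1 e2 m : R -> R) (y : R * R) (w : R)
  (j : nat) :
  ex_derive e1 w -> ex_derive e2 w -> ex_derive m w ->
  ex_derive (fun w => fst (transfer M (e1 w) (e2 w) (m w) j y)) w /\
  ex_derive (fun w => snd (transfer M (e1 w) (e2 w) (m w) j y)) w.
Proof.
  intros h1 h2 hm. induction j as [|j [IH1 IH2]].
  - split; [apply (ex_derive_const (fst y)) | apply (ex_derive_const (snd y))].
  - apply (flow_ex_derive (fun w => particle_eps (e1 w) (e2 w) j) m
      (fun w => transfer M (e1 w) (e2 w) (m w) j y)); auto.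
    apply (particle_eps_ind (fun e => ex_derive e w)); auto.
Qed.

Lemma signed_root_ex_derive (a : R) : 1 < Rabs a -> ex_derive signed_root a.
Proof.
  intros h. pose proof (signed_root_arg a h). pose proof (one_lt_sqr a h).
  unfold signed_root. auto_derive. split; [nra|]. split; [lra|]. exact I.
Qed.

Lemma gap_impedance_ex_derive (M : unit_cell) (e1 e2 m : R -> R) (w : R) :
  ex_derive e1 w -> ex_derive e2 w -> ex_derive m w ->
  1 < Rabs (mon_a M (e1 w) (e2 w) (m w)) ->
  ex_derive (fun w => gap_impedance M (e1 w) (e2 w) (m w)) w.
Proof.
  intros h1 h2 hm ha.
  destruct (transfer_ex_derive M e1 e2 m (1, 0) w (2 * cell_N M + 1) h1 h2 hm) as [hda _].
  destruct (transfer_ex_derive M e1 e2 m (0, 1) w (2 * cell_N M + 1) h1 h2 hm) as [hdb _].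
  unfold gap_impedance.
  apply (ex_derive_opp (fun w => mon_b M (e1 w) (e2 w) (m w) /
    signed_root (mon_a M (e1 w) (e2 w) (m w)))).
  apply ex_derive_div.
  - exact hdb.
  - apply (ex_derive_comp signed_root); [apply signed_root_ex_derive, ha | exact hda].
  - intros e. pose proof (signed_root_sign _ ha) as hs. rewrite e in hs. lra.
Qed.

(** * Growth of the Wronskian of two frequencies *)

Lemma flow_continuity_2d (e m : R -> R) (y : R -> R * R) (x w : R) :
  continuity_pt e w -> continuity_pt m w ->
  continuity_pt (fun w => fst (y w)) w -> continuity_pt (fun w => snd (y w)) w ->
  continuity_2d_pt (fun x w => fst (flow (e w) (m w) x (y w))) x w /\
  continuity_2d_pt (fun x w => snd (flow (e w) (m w) x (y w))) x w.
Proof.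
  intros he hm h1 h2.
  assert (hw : forall f, continuity_pt f w -> continuity_2d_pt (fun _ w => f w) x w).
  { intros f hf. apply (continuity_1d_2d_pt_comp f (fun _ w => w)); [exact hf|].
    apply continuity_2d_pt_id2. }
  assert (hx : continuity_2d_pt (fun x _ => x) x w) by apply continuity_2d_pt_id1.
  assert (harg : continuity_2d_pt (fun x w => - (e w * m w * (x * (x * 1)))) x w).
  { apply continuity_2d_pt_opp, continuity_2d_pt_mult.
    - apply continuity_2d_pt_mult; apply hw; assumption.
    - apply continuity_2d_pt_mult; [exact hx|].
      apply continuity_2d_pt_mult; [exact hx | apply continuity_2d_pt_const]. }
  assert (hpt : forall (f : R -> R) z d, is_derive f z d -> continuity_pt f z).
  { intros f z d h. apply continuity_pt_filterlim, (continuous_of_derive f z d h). }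
  assert (hC : continuity_2d_pt (fun x w => cos_prop (e w * m w) x) x w).
  { apply (continuity_1d_2d_pt_comp Ck); [eapply hpt, Ck_derive | exact harg]. }
  assert (hS : continuity_2d_pt (fun x w => sin_prop (e w * m w) x) x w).
  { apply continuity_2d_pt_mult; [exact hx|].
    apply (continuity_1d_2d_pt_comp Sk); [eapply hpt, Sk_derive | exact harg]. }
  unfold flow; cbn [fst snd]. split.
  - apply continuity_2d_pt_plus; apply continuity_2d_pt_mult; auto.
    apply continuity_2d_pt_mult; auto.
  - apply continuity_2d_pt_plus; apply continuity_2d_pt_mult; auto.
    apply continuity_2d_pt_mult; auto. apply continuity_2d_pt_opp; auto.
Qed.

Lemma continuity_2d_snd (f : R -> R -> R) (x w : R) :
  continuity_2d_pt f x w -> continuity_pt (fun w => f x w) w.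
Proof.
  intros h. apply continuity_pt_locally. intros eps.
  destruct (h eps) as [d hd]. exists d. intros v hv. apply hd; [|exact hv].
  rewrite Rminus_diag, Rabs_R0. apply cond_pos.
Qed.

Lemma transfer_continuity (M : unit_cell) (e1 e2 m : R -> R) (y : R -> R * R) (w : R)
  (j : nat) :
  continuity_pt e1 w -> continuity_pt e2 w -> continuity_pt m w ->
  continuity_pt (fun w => fst (y w)) w -> continuity_pt (fun w => snd (y w)) w ->
  continuity_pt (fun w => fst (transfer M (e1 w) (e2 w) (m w) j (y w))) w /\
  continuity_pt (fun w => snd (transfer M (e1 w) (e2 w) (m w) j (y w))) w.
Proof.
  intros h1 h2 hm hy1 hy2. induction j as [|j [IH1 IH2]]; [auto|].
  destruct (flow_continuity_2d (fun w => particle_eps (e1 w) (e2 w) j) m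
      (fun w => transfer M (e1 w) (e2 w) (m w) j (y w)) (node M (S j) - node M j) w)
    as [hf hs]; auto.
  { apply (particle_eps_ind (fun e => continuity_pt e w)); auto. }
  split; [exact (continuity_2d_snd _ _ _ hf) | exact (continuity_2d_snd _ _ _ hs)].
Qed.

(** Lower bounds, uniform in [x], for a kernel near a frequency [w0] at which it
    is nonnegative, and positive at [x1]. *)
Lemma kernel_lower (K : R -> R -> R) (L w0 x1 : R) :
  (forall x, 0 <= x <= L -> continuity_2d_pt K x w0) ->
  (forall x, 0 <= x <= L -> 0 <= K x w0) -> 0 <= x1 <= L -> 0 < K x1 w0 ->
  exists d, 0 < d /\
    locally w0 (fun w => forall x, 0 <= x <= L -> Rabs (x - x1) < d -> K x1 w0 / 2 <= K x w) /\
    forall eta, 0 < eta ->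
      locally w0 (fun w => forall x, 0 <= x <= L -> - eta <= K x w).
Proof.
  intros hc hp hx1 hk.
  destruct (uniform_continuity_2d_1d K 0 L w0 hc (mkposreal (K x1 w0 / 2) ltac:(lra)))
    as [d hd]. simpl in hd.
  assert (hnear : forall (d : posreal) w, ball w0 d w -> w0 - d <= w <= w0 + d).
  { intros d' w hw. change (Rabs (w - w0) < d') in hw. apply Rabs_def2 in hw. lra. }
  exists d. split; [apply cond_pos|]. split.
  - exists d. intros w hw x hx hxd. pose proof (cond_pos d).
    specialize (hd x1 w0 x w hx1 ltac:(lra) hx (hnear d w hw) hxd).
    apply Rabs_def2 in hd. lra.
  - intros eta heta.
    destruct (uniform_continuity_2d_1d K 0 L w0 hc (mkposreal eta heta)) as [d' hd'].
    simpl in hd'. exists d'. intros w hw x hx. pose proof (cond_pos d').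
    specialize (hd' x w0 x w hx ltac:(lra) hx (hnear d' w hw)).
    rewrite Rminus_diag, Rabs_R0 in hd'. specialize (hd' (cond_pos d')).
    apply Rabs_def2 in hd'. specialize (hp x hx). lra.
Qed.

Lemma slope_lower (f df : R -> R) (a b k : R) :
  a <= b -> (forall x, a <= x <= b -> is_derive f x (df x) /\ k <= df x) ->
  k * (b - a) <= f b - f a.
Proof.
  intros hab h.
  assert (hm : f a - k * a <= f b - k * b).
  { apply (nondecreasing_off_finite nil (fun x => f x - k * x) (fun x => df x - k)); auto.
    - intros x hx. eapply continuous_of_derive.
      apply (is_derive_minus f (fun x => k * x)); [apply h, hx|].
      apply is_derive_scal, is_derive_id.
    - intros x hx _. destruct (h x ltac:(lra)) as [hd hk]. split; [|lra].
      evar_last.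
      + apply (is_derive_minus f (fun x => k * x)); [exact hd|].
        apply is_derive_scal, is_derive_id.
      + unfold minus, plus, opp, one; simpl. ring. }
  lra.
Qed.

(** The constant [c] does not depend on [A] and [B].  These will be the increments
    of the permittivity and of [m], whose ratio is not controlled. *)
Lemma two_kernels_increase (K1 K2 : R -> R -> R) (L w0 x1 : R) :
  (forall x, 0 <= x <= L -> continuity_2d_pt K1 x w0 /\ continuity_2d_pt K2 x w0) ->
  (forall x, 0 <= x <= L -> 0 <= K1 x w0 /\ 0 <= K2 x w0) ->
  0 < x1 < L -> 0 < K1 x1 w0 -> 0 < K2 x1 w0 ->
  exists c, 0 < c /\ locally w0 (fun w => forall (A B : R) (f : R -> R),
    0 <= A -> 0 <= B ->
    (forall x, 0 <= x <= L -> is_derive f x (A * K1 x w + B * K2 x w)) ->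
    c * (A + B) <= f L - f 0).
Proof.
  intros hc hp hx1 hk1 hk2.
  destruct (kernel_lower K1 L w0 x1) as [d1 [hd1 [hl1 hu1]]]; auto; try lra;
    try (intros x hx; destruct (hc x hx); destruct (hp x hx); assumption).
  destruct (kernel_lower K2 L w0 x1) as [d2 [hd2 [hl2 hu2]]]; auto; try lra;
    try (intros x hx; destruct (hc x hx); destruct (hp x hx); assumption).
  set (k := Rmin (K1 x1 w0 / 2) (K2 x1 w0 / 2)).
  set (d := Rmin (Rmin d1 d2) (Rmin x1 (L - x1)) / 2).
  assert (hk : 0 < k) by (apply Rmin_glb_lt; lra).
  assert (hd : 0 < d).
  { unfold d. apply Rdiv_lt_0_compat; [|lra].
    apply Rmin_glb_lt; apply Rmin_glb_lt; lra. }
  pose proof (Rmin_l (Rmin d1 d2) (Rmin x1 (L - x1))) as m1.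
  pose proof (Rmin_r (Rmin d1 d2) (Rmin x1 (L - x1))) as m2.
  pose proof (Rmin_l d1 d2). pose proof (Rmin_r d1 d2).
  pose proof (Rmin_l x1 (L - x1)). pose proof (Rmin_r x1 (L - x1)).
  assert (h2d : Rmin (Rmin d1 d2) (Rmin x1 (L - x1)) = 2 * d) by (unfold d; field).
  rewrite h2d in m1, m2. clearbody d.
  pose proof (Rmin_l (K1 x1 w0 / 2) (K2 x1 w0 / 2)) as m3.
  pose proof (Rmin_r (K1 x1 w0 / 2) (K2 x1 w0 / 2)) as m4. fold k in m3, m4.
  (* the loss outside the window around [x1] is at most half the gain inside *)
  set (eta := k * d / L).
  assert (heta : 0 < eta) by (apply Rdiv_lt_0_compat; nra).
  assert (hetaL : eta * L = k * d) by (unfold eta; field; lra).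
  exists (k * d). split; [nra|].
  generalize (filter_and _ _ (filter_and _ _ hl1 hl2)
    (filter_and _ _ (hu1 eta heta) (hu2 eta heta))).
  apply filter_imp. intros w [[l1 l2] [u1 u2]] A B f hA hB hf.
  assert (s1 : (- eta * (A + B)) * ((x1 - d) - 0) <= f (x1 - d) - f 0).
  { eapply slope_lower; [lra|]. intros x hx. split; [apply hf; lra|].
    specialize (u1 x ltac:(lra)). specialize (u2 x ltac:(lra)). nra. }
  assert (s2 : (k * (A + B)) * ((x1 + d) - (x1 - d)) <= f (x1 + d) - f (x1 - d)).
  { eapply slope_lower; [lra|]. intros x hx. split; [apply hf; lra|].
    specialize (l1 x ltac:(lra) ltac:(apply Rabs_def1; lra)).
    specialize (l2 x ltac:(lra) ltac:(apply Rabs_def1; lra)). nra. }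
  assert (s3 : (- eta * (A + B)) * (L - (x1 + d)) <= f L - f (x1 + d)).
  { eapply slope_lower; [lra|]. intros x hx. split; [apply hf; lra|].
    specialize (u1 x ltac:(lra)). specialize (u2 x ltac:(lra)). nra. }
  assert (s4 : (k * d) * (A + B) = (eta * L) * (A + B)) by (rewrite hetaL; ring).
  assert (0 <= eta * (A + B) * d).
  { apply Rmult_le_pos; [|lra]. apply Rmult_le_pos; lra. }
  lra.
Qed.

Lemma flow_nonzero (e m x : R) (y : R * R) : y <> (0, 0) -> flow e m x y <> (0, 0).
Proof.
  intros hy h. apply hy.
  pose proof (flow_wronskian e m x y (1, 0)) as w1.
  pose proof (flow_wronskian e m x y (0, 1)) as w2.
  rewrite h in w1, w2. unfold wronskian in w1, w2. cbn [fst snd] in w1, w2.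
  rewrite (surjective_pairing y). f_equal; lra.
Qed.

Lemma transfer_nonzero (M : unit_cell) (e1 e2 m : R) (y : R * R) (j : nat) :
  y <> (0, 0) -> transfer M e1 e2 m j y <> (0, 0).
Proof. intros hy. induction j; [exact hy | apply flow_nonzero; assumption]. Qed.

(** Some point of a particle is a zero neither of the value nor of the flux:
    if [u q] vanished identically, so would [(u q)' = e q^2 - m u^2], and then [u]
    and [q] would vanish together. *)
Lemma flow_generic_point (e m L : R) (y : R * R) :
  e <> 0 -> m <> 0 -> 0 < L -> y <> (0, 0) ->
  exists x, 0 < x < L /\ fst (flow e m x y) <> 0 /\ snd (flow e m x y) <> 0.
Proof.
  intros he hm hL hy. apply Classical_Prop.NNPP. intros hn.
  assert (h0 : forall x, 0 < x < L -> fst (flow e m x y) * snd (flow e m x y) = 0).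
  { intros x hx. apply Classical_Prop.NNPP. intros h. apply hn. exists x.
    split; [exact hx|]. split; intros h'; apply h; rewrite h'; ring. }
  set (x := L / 2).
  assert (hd : is_derive (fun x => fst (flow e m x y) * snd (flow e m x y)) x
    (e * snd (flow e m x y) * snd (flow e m x y)
     + fst (flow e m x y) * (- m * fst (flow e m x y)))).
  { apply (is_derive_mult (fun x => fst (flow e m x y)) (fun x => snd (flow e m x y)));
      [apply flow_derive_fst | apply flow_derive_snd | intros; apply Rmult_comm]. }
  apply is_derive_unique in hd.
  rewrite (Derive_ext_loc _ (fun _ => 0)), Derive_const in hd.
  - specialize (h0 x ltac:(unfold x; lra)).
    apply (flow_nonzero e m x y hy). rewrite (surjective_pairing (flow e m x y)).
    apply Rmult_integral in h0. destruct h0 as [h0|h0]; rewrite h0 in *; f_equal.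
    + apply Rsqr_eq_0. apply (Rmult_eq_reg_l e); [|exact he]. unfold Rsqr. lra.
    + apply Rsqr_eq_0. apply (Rmult_eq_reg_l m); [|exact hm]. unfold Rsqr. lra.
  - apply (locally_interval _ x 0 L); simpl; try (unfold x; lra).
    intros t h1 h2. apply h0; lra.
Qed.

Lemma flow_wronskian_derive (e e' m m' x : R) (y z : R * R) :
  is_derive (fun x => wronskian (flow e m x y) (flow e' m' x z)) x
    ((e' - e) * (snd (flow e m x y) * snd (flow e' m' x z)) +
     (m' - m) * (fst (flow e m x y) * fst (flow e' m' x z))).
Proof.
  evar_last.
  - apply (is_derive_minus (fun x => fst (flow e' m' x z) * snd (flow e m x y))
      (fun x => fst (flow e m x y) * snd (flow e' m' x z))).
    + apply (is_derive_mult (fun x => fst (flow e' m' x z)) (fun x => snd (flow e m x y)));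
        [apply flow_derive_fst | apply flow_derive_snd | intros; apply Rmult_comm].
    + apply (is_derive_mult (fun x => fst (flow e m x y)) (fun x => snd (flow e' m' x z)));
        [apply flow_derive_fst | apply flow_derive_snd | intros; apply Rmult_comm].
  - unfold minus, plus, opp, mult; simpl. ring.
Qed.

Lemma at_right_locally (P : R -> Prop) (w : R) : locally w P -> at_right w P.
Proof. apply filter_le_within. Qed.

(** As [w] decreases to [w0], the derivative of the Wronskian of the two flows
    tends to a combination of squares with nonnegative coefficients, the second of
    which is at least [k (w - w0)]. *)
Lemma particle_increase (e m : R -> R) (y : R -> R * R) (L w0 k : R) :
  0 < L -> 0 < k -> e w0 <> 0 -> m w0 <> 0 -> y w0 <> (0, 0) ->
  continuity_pt e w0 -> continuity_pt m w0 ->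
  continuity_pt (fun w => fst (y w)) w0 -> continuity_pt (fun w => snd (y w)) w0 ->
  at_right w0 (fun w => e w0 <= e w) ->
  at_right w0 (fun w => k * (w - w0) <= m w - m w0) ->
  exists c, 0 < c /\ at_right w0 (fun w => c * (w - w0) <=
    wronskian (flow (e w0) (m w0) L (y w0)) (flow (e w) (m w) L (y w))
    - wronskian (y w0) (y w)).
Proof.
  intros hL hk he0 hm0 hy0 he hm hy1 hy2 hemon hmmon.
  destruct (flow_generic_point (e w0) (m w0) L (y w0) he0 hm0 hL hy0)
    as [x1 [hx1 [hu hq]]].
  assert (hcst : forall x, continuity_2d_pt (fun x _ => fst (flow (e w0) (m w0) x (y w0))) x w0
    /\ continuity_2d_pt (fun x _ => snd (flow (e w0) (m w0) x (y w0))) x w0).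
  { intros x. apply (flow_continuity_2d (fun _ => e w0) (fun _ => m w0) (fun _ => y w0));
    apply continuity_pt_const; intros ? ?; reflexivity. }
  assert (hvar : forall x, continuity_2d_pt (fun x w => fst (flow (e w) (m w) x (y w))) x w0
    /\ continuity_2d_pt (fun x w => snd (flow (e w) (m w) x (y w))) x w0).
  { intros x. apply flow_continuity_2d; assumption. }
  destruct (two_kernels_increase
    (fun x w => snd (flow (e w0) (m w0) x (y w0)) * snd (flow (e w) (m w) x (y w)))
    (fun x w => fst (flow (e w0) (m w0) x (y w0)) * fst (flow (e w) (m w) x (y w)))
    L w0 x1) as [c [hc hinc]].
  - intros x _. destruct (hcst x), (hvar x).
    split; apply continuity_2d_pt_mult; assumption.
  - intros x _. split; apply Rle_0_sqr.
  - exact hx1.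
  - apply Rsqr_pos_lt, hq.
  - apply Rsqr_pos_lt, hu.
  - exists (c * k). split; [nra|].
    generalize (filter_and _ _ (at_right_locally _ _ hinc) (filter_and _ _ hemon hmmon)).
    intros hall.
    assert (hgt : at_right w0 (fun w => w0 < w)).
    { exists (mkposreal 1 Rlt_0_1). auto. }
    generalize (filter_and _ _ hall hgt). apply filter_imp.
    intros w [[hi [h1 h2]] hw].
    specialize (hi (e w - e w0) (m w - m w0)
      (fun x => wronskian (flow (e w0) (m w0) x (y w0)) (flow (e w) (m w) x (y w)))).
    cbv beta in hi. rewrite !flow_0 in hi.
    eapply Rle_trans; [|apply hi].
    + rewrite Rmult_assoc. apply Rmult_le_compat_l; lra.
    + lra.
    + nra.
    + intros x _. apply flow_wronskian_derive.
Qed.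

(** Summation over the first [j] particles; for [j = 0] the increment is 0. *)
Lemma transfer_increase (M : unit_cell) (e1 e2 m : R -> R) (y : R -> R * R)
  (w0 k : R) (j : nat) :
  (j <= 2 * cell_N M + 1)%nat ->
  0 < k -> e1 w0 <> 0 -> e2 w0 <> 0 -> m w0 <> 0 -> y w0 <> (0, 0) ->
  continuity_pt e1 w0 -> continuity_pt e2 w0 -> continuity_pt m w0 ->
  continuity_pt (fun w => fst (y w)) w0 -> continuity_pt (fun w => snd (y w)) w0 ->
  at_right w0 (fun w => e1 w0 <= e1 w) -> at_right w0 (fun w => e2 w0 <= e2 w) ->
  at_right w0 (fun w => k * (w - w0) <= m w - m w0) ->
  exists c, ((0 < j)%nat -> 0 < c) /\ 0 <= c /\ at_right w0 (fun w => c * (w - w0) <=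
    wronskian (transfer M (e1 w0) (e2 w0) (m w0) j (y w0))
      (transfer M (e1 w) (e2 w) (m w) j (y w))
    - wronskian (y w0) (y w)).
Proof.
  intros hj hk h1 h2 hm0 hy0 c1 c2 cm cy1 cy2 i1 i2 im.
  induction j as [|j IH].
  - exists 0. split; [lia|]. split; [lra|]. apply filter_forall. intros w. simpl. lra.
  - destruct (IH ltac:(lia)) as [c [_ [hc hinc]]].
    destruct (transfer_continuity M e1 e2 m y w0 j c1 c2 cm cy1 cy2) as [t1 t2].
    destruct (particle_increase (fun w => particle_eps (e1 w) (e2 w) j) m
      (fun w => transfer M (e1 w) (e2 w) (m w) j (y w))
      (node M (S j) - node M j) w0 k) as [c' [hc' hinc']]; auto.
    + pose proof (node_lt M j (S j) ltac:(lia) hj). lra.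
    + apply (particle_eps_ind (fun e => e w0 <> 0)); assumption.
    + apply transfer_nonzero, hy0.
    + apply (particle_eps_ind (fun e => continuity_pt e w0)); assumption.
    + apply (particle_eps_ind (fun e => at_right w0 (fun w => e w0 <= e w))); assumption.
    + exists (c + c'). split; [lra|]. split; [lra|].
      generalize (filter_and _ _ hinc hinc'). apply filter_imp.
      intros w [a b]. cbn [transfer]. lra.
Qed.

(** * Sign of the slope *)

Lemma Derive_neg_of_slope (f : R -> R) (w0 c : R) :
  0 < c -> at_right w0 (fun w => f w - f w0 <= - c * (w - w0)) ->
  ex_derive f w0 -> Derive f w0 < 0.
Proof.
  intros hc [d hd] hex.
  pose proof (proj1 (is_derive_Reals _ _ _) (Derive_correct f w0 hex)) as hl.
  destruct (hl c hc) as [d' hd'].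
  set (h := Rmin d d' / 2).
  assert (h0 : 0 < Rmin d d') by (apply Rmin_glb_lt; apply cond_pos).
  pose proof (Rmin_l d d'). pose proof (Rmin_r d d').
  assert (hh : 0 < h) by (unfold h; lra).
  specialize (hd' h ltac:(lra)). rewrite Rabs_pos_eq in hd' by lra.
  specialize (hd' ltac:(unfold h; lra)). apply Rabs_def2 in hd'.
  assert (hb : f (w0 + h) - f w0 <= - c * (w0 + h - w0)).
  { apply hd; [|lra]. change (Rabs (w0 + h - w0) < d).
    replace (w0 + h - w0) with h by ring. rewrite Rabs_pos_eq; unfold h; lra. }
  assert ((f (w0 + h) - f w0) / h <= - c).
  { apply Rmult_le_reg_r with h; [exact hh|].
    unfold Rdiv. rewrite Rmult_assoc, Rinv_l, Rmult_1_r by lra. lra. }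
  lra.
Qed.

(** The exceptional frequencies being isolated, the permittivity is differentiable
    on a right neighbourhood of [w0], up to [w0] excluded. *)
Lemma permittivity_right (eps : R -> R) (w0 : R) :
  permittivity eps -> at_right w0 (fun w => eps w0 <= eps w).
Proof.
  intros [hc [hd hp]]. destruct (hd w0) as [d h]. exists d. intros w hw hlt.
  apply (nondecreasing_off_finite nil eps (Derive eps)); [lra | auto |].
  intros x hx _.
  assert (hx' : ex_derive eps x).
  { apply h; [|lra]. change (Rabs (w - w0) < d) in hw. change (Rabs (x - w0) < d).
    rewrite Rabs_pos_eq in * by lra. lra. }
  split; [apply Derive_correct, hx' | apply hp, hx'].
Qed.

(** The Wronskian of the two decaying solutions is multiplied over a cell by the
    product [l] of their multipliers; as it increases and [-1 < l < 1], it is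
    negative at 0. *)
Lemma gap_impedance_slope (M : unit_cell) (e1 e2 m : R -> R) (w0 k : R) :
  0 < k -> e1 w0 <> 0 -> e2 w0 <> 0 -> m w0 <> 0 ->
  continuity_pt e1 w0 -> continuity_pt e2 w0 -> continuity_pt m w0 ->
  at_right w0 (fun w => e1 w0 <= e1 w) -> at_right w0 (fun w => e2 w0 <= e2 w) ->
  at_right w0 (fun w => k * (w - w0) <= m w - m w0) ->
  locally w0 (fun w => mon_d M (e1 w) (e2 w) (m w) = mon_a M (e1 w) (e2 w) (m w) /\
    1 < Rabs (mon_a M (e1 w) (e2 w) (m w))) ->
  exists c, 0 < c /\ at_right w0 (fun w =>
    gap_impedance M (e1 w) (e2 w) (m w) - gap_impedance M (e1 w0) (e2 w0) (m w0)
    <= - c * (w - w0)).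
Proof.
  intros hk h1 h2 hm0 c1 c2 cm i1 i2 im hloc.
  set (a := fun w => mon_a M (e1 w) (e2 w) (m w)) in *.
  set (b := fun w => mon_b M (e1 w) (e2 w) (m w)) in *.
  set (r := fun w => signed_root (a w)).
  destruct (locally_singleton _ _ hloc) as [hd0 ha0]. fold (a w0) in ha0.
  assert (ccst : forall v : R, continuity_pt (fun _ => v) w0)
    by (intros v; apply continuity_pt_const; intros ? ?; reflexivity).
  assert (cb : continuity_pt b w0).
  { apply (transfer_continuity M e1 e2 m (fun _ => (0, 1))); auto. }
  assert (ca : continuity_pt a w0).
  { apply (transfer_continuity M e1 e2 m (fun _ => (1, 0))); auto. }
  assert (cr : continuity_pt r w0).
  { apply (continuity_pt_comp a signed_root); [exact ca|].
    apply continuity_pt_filterlim, (ex_derive_continuous signed_root).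
    apply signed_root_ex_derive, ha0. }
  assert (hr0 : 0 < r w0 * r w0).
  { apply Rsqr_pos_lt. intros e. pose proof (signed_root_sign _ ha0) as hs.
    fold (r w0) in hs. rewrite e in hs. lra. }
  destruct (transfer_increase M e1 e2 m (fun w => (b w, - r w)) w0 k (2 * cell_N M + 1))
    as [c [hc [_ hinc]]]; auto.
  { intros e. injection e. intros e' _. nra. }
  { cbn [snd]. apply (continuity_pt_opp r), cr. }
  specialize (hc ltac:(lia)).
  exists (c / (4 * (r w0 * r w0))). split; [apply Rdiv_lt_0_compat; lra|].
  assert (hrr : at_right w0 (fun w => 0 < r w0 * r w < 2 * (r w0 * r w0))).
  { apply filter_le_within.
    assert (crr : continuity_pt (fun w => r w0 * r w) w0)
      by (apply (continuity_pt_scal r (r w0)), cr).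
    destruct (proj1 (continuity_pt_locally _ _) crr (mkposreal _ hr0)) as [d hd].
    exists d. intros w hw. specialize (hd w hw). simpl in hd. apply Rabs_def2 in hd. lra. }
  assert (hgt : at_right w0 (fun w => w0 < w)) by (exists (mkposreal 1 Rlt_0_1); auto).
  generalize (filter_and _ _ (filter_and _ _ hinc (at_right_locally _ _ hloc))
    (filter_and _ _ hrr hgt)).
  apply filter_imp. intros w [[hi [hd ha]] [hr hw]]. fold (a w) in ha.
  assert (heig : forall w, mon_d M (e1 w) (e2 w) (m w) = a w -> 1 < Rabs (a w) ->
    transfer M (e1 w) (e2 w) (m w) (2 * cell_N M + 1) (b w, - r w) =
    ((a w - r w) * b w, (a w - r w) * - r w)).
  { intros v hdv hav.
    change (monodromy M (e1 v) (e2 v) (m v) (b v, - r v) =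
      ((a v - r v) * b v, (a v - r v) * - r v)).
    destruct (signed_root_hyperbolic M _ _ _ hdv hav) as [_ [hsq _]].
    fold (a v) in hsq. fold (r v) in hsq. fold (b v) in hsq.
    rewrite monodromy_matrix, hdv. fold (a v) (b v). f_equal; lra. }
  rewrite !heig in hi by assumption.
  pose proof (signed_root_contract _ ha) as l1. fold (r w) in l1.
  pose proof (signed_root_contract _ ha0) as l0. fold (r w0) in l0.
  (* [W] is the Wronskian of the two solutions at 0 *)
  set (W := b w0 * r w - b w * r w0).
  set (l := (a w0 - r w0) * (a w - r w)).
  assert (hl : -1 < l < 1).
  { apply Rabs_def2 in l1, l0. unfold l. nra. }
  assert (hWl : c * (w - w0) <= (l - 1) * W).
  { unfold wronskian in hi. cbn [fst snd] in hi. unfold l, W. lra. }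
  assert (hcw : 0 < c * (w - w0)) by nra.
  assert (hW : W <= - (c / 2) * (w - w0)).
  { assert (W < 0) by nra. nra. }
  assert (hr0' : r w0 <> 0) by nra. assert (hrw' : r w <> 0) by nra.
  unfold gap_impedance. fold (a w) (a w0) (b w) (b w0). fold (r w) (r w0).
  replace (- (b w / r w) - - (b w0 / r w0)) with (W / (r w0 * r w))
    by (unfold W; field; auto).
  apply Rmult_le_reg_r with (r w0 * r w); [lra|].
  unfold Rdiv at 1. rewrite Rmult_assoc, Rinv_l, Rmult_1_r by lra.
  eapply Rle_trans; [exact hW|].
  set (t := c / (4 * (r w0 * r w0))).
  assert (ht : t * (4 * (r w0 * r w0)) = c) by (unfold t; field; lra).
  assert (htp : 0 < t) by (apply Rdiv_lt_0_compat; lra).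
  assert (htw : 0 < t * (w - w0)) by nra.
  rewrite <- ht.
  assert (t * (w - w0) * (r w0 * r w) <= t * (w - w0) * (2 * (r w0 * r w0))).
  { apply Rmult_le_compat_l; lra. }
  lra.
Qed.

Lemma gap_impedance_monotone (mu0 : R) (eps1 eps2 : R -> R) (M : unit_cell)
  (gap : R -> Prop) (Z : R -> R) :
  0 < mu0 -> permittivity eps1 -> permittivity eps2 -> mirror_symmetric eps1 eps2 M ->
  band_gap mu0 eps1 eps2 M gap ->
  (forall w, gap w -> eps1 w <> 0 -> eps2 w <> 0 ->
    Z w = gap_impedance M (eps1 w) (eps2 w) (mu0 * w ^ 2)) ->
  forall w, gap w -> 0 < w -> eps1 w <> 0 -> eps2 w <> 0 ->
    (ex_derive eps1 w -> ex_derive eps2 w -> ex_derive Z w) /\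
    (ex_derive Z w -> Derive Z w < 0).
Proof.
  intros hmu p1 p2 hsym hgap hZ w hw hpos h1 h2.
  assert (hopen : locally w gap).
  { destruct hgap as [a [b [_ [hg _]]]]. apply hg in hw.
    apply (locally_interval _ w a b); simpl; try lra. intros y ha hb. apply hg. lra. }
  assert (hnz : forall eps, permittivity eps -> eps w <> 0 -> locally w (fun v => eps v <> 0)).
  { intros eps [hc _] h. apply (hc w (fun y => y <> 0)). apply open_neq, h. }
  assert (hgood : locally w (fun v => gap v /\ eps1 v <> 0 /\ eps2 v <> 0)).
  { apply filter_and; [exact hopen|]. apply filter_and; auto. }
  assert (heq : locally w (fun v =>
    gap_impedance M (eps1 v) (eps2 v) (mu0 * v ^ 2) = Z v)).
  { generalize hgood. apply filter_imp. intros v [g [n1 n2]]. symmetry. auto. }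
  assert (hhyp : locally w (fun v =>
    mon_d M (eps1 v) (eps2 v) (mu0 * v ^ 2) = mon_a M (eps1 v) (eps2 v) (mu0 * v ^ 2) /\
    1 < Rabs (mon_a M (eps1 v) (eps2 v) (mu0 * v ^ 2)))).
  { generalize hgood. apply filter_imp. intros v [g [n1 n2]]. split.
    - apply mirror_mon_d, eps_medium_mirror, hsym.
    - apply (impedances_in_gap mu0 eps1 eps2 M gap v); assumption. }
  assert (hdm : ex_derive (fun v => mu0 * v ^ 2) w) by (auto_derive; exact I).
  split.
  - intros d1 d2. eapply ex_derive_ext_loc; [exact heq|].
    apply (gap_impedance_ex_derive M eps1 eps2 (fun v => mu0 * v ^ 2)); auto.
    apply (locally_singleton _ _ hhyp).
  - assert (hcont : forall eps, permittivity eps -> continuity_pt eps w)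
      by (intros eps [hc _]; apply continuity_pt_filterlim, hc).
    destruct (gap_impedance_slope M eps1 eps2 (fun v => mu0 * v ^ 2) w (mu0 * w))
      as [c [hc hsl]]; auto.
    + nra.
    + apply Rgt_not_eq, Rmult_lt_0_compat; [exact hmu | apply pow_lt, hpos].
    + apply continuity_pt_filterlim, (ex_derive_continuous (fun v => mu0 * v ^ 2)), hdm.
    + apply permittivity_right, p1.
    + apply permittivity_right, p2.
    + exists (mkposreal 1 Rlt_0_1). intros v _ hv. simpl.
      assert (0 < mu0 * (v - w) * v) by (apply Rmult_lt_0_compat; nra). nra.
    + apply (Derive_neg_of_slope Z w c hc).
      generalize (filter_and _ _ hsl (at_right_locally _ _ heq)).
      apply filter_imp. intros v [hv ev].
      rewrite <- ev, <- (locally_singleton _ _ heq). exact hv.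
Qed.

Theorem theorem3p12 (mu0 : R) (eps1 eps2 : R -> R) (A B : unit_cell)
  (gap : R -> Prop)
  (hmu0 : 0 < mu0)
  (heps1 : permittivity eps1) (heps2 : permittivity eps2)
  (hA : mirror_symmetric eps1 eps2 A) (hB : mirror_symmetric eps1 eps2 B) :
  (band_gap mu0 eps1 eps2 B gap ->
   forall w : R, gap w -> 0 < w -> eps1 w <> 0 -> eps2 w <> 0 ->
     (ex_derive eps1 w -> ex_derive eps2 w ->
      ex_derive (impedance_plus mu0 eps1 eps2 B) w) /\
     (ex_derive (impedance_plus mu0 eps1 eps2 B) w ->
      Derive (impedance_plus mu0 eps1 eps2 B) w < 0)) /\
  (band_gap mu0 eps1 eps2 A gap ->
   forall w : R, gap w -> 0 < w -> eps1 w <> 0 -> eps2 w <> 0 ->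
     (ex_derive eps1 w -> ex_derive eps2 w ->
      ex_derive (impedance_minus mu0 eps1 eps2 A) w) /\
     (ex_derive (impedance_minus mu0 eps1 eps2 A) w ->
      Derive (impedance_minus mu0 eps1 eps2 A) w < 0)).
Proof.
  split; intros hgap.
  - apply (gap_impedance_monotone mu0 eps1 eps2 B gap); auto.
    intros w hw h1 h2. eapply impedances_in_gap; eauto.
  - apply (gap_impedance_monotone mu0 eps1 eps2 A gap); auto.
    intros w hw h1 h2. eapply impedances_in_gap; eauto.
Qed.
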